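(* As $n\to\infty$, for every $A>1$, $$\sup_{t\in[1,A]}|\Lambda_{k,n}(t)-\Lambda^\circ(t)|\xrightarrow{\mathbb{P}}0,\qquad \sup_{t\in[1,A]}|F_{k,n}(t)-F^\circ(t)|\xrightarrow{\mathbb{P}}0 .$$
   Context: Setting. $\{X_i\}_{i\ge1}$ and $\{Y_i\}_{i\ge1}$ are independent i.i.d. sequences with distribution functions $F_X,F_Y$. For $i\in\{X,Y\}$, $1-F_i(x)=L_i(x)x^{-1/\gamma_i}$ with $\gamma_i>0$ and $L_i$ slowly varying at infinity ($L_i(tx)/L_i(t)\to1$ as $t\to\infty$ for every $x>0$). One observes $Z_i=\min\{X_i,Y_i\}$ and $\delta_i=I(X_i\le Y_i)$, $i=1,\dots,n$. $F_Z$ is the distribution function of $Z_1$, and $Z_{1,n}\le\dots\le Z_{n,n}$ are the order statistics. Put $\gamma=\frac{\gamma_X\gamma_Y}{\gamma_X+\gamma_Y}$, $p=\frac{\gamma_Y}{\gamma_X+\gamma_Y}$. Let $k=k_n$ be an integer sequence with $k\to\infty$, $k/n\to0$, and $u_n=F_Z^{\leftarrow}(1-k/n)$ with $n(1-F_Z(u_n))=k$. Standing assumption (Condition 1). With $p(s)=\mathbb{P}(\delta_1=1\mid Z_1>s)$: $\sqrt{k}(p(u_n)-p)\to0$, and for every $[a,b]\subset(0,\infty)$, $$\limsup_{n\to\infty}\sqrt{k}\sup_{a\le s\le t<b}\Big|\frac{\mathbb{P}(u_ns<Z_1\le u_nt,\ \delta_1=1)}{1-F_Z(u_n)}-p\,(s^{-1/\gamma}-t^{-1/\gamma})\Big|=0.$$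 Notation. For $s>0$, $\widehat T_n(s)=\frac1k\sum_{i=1}^nI(Z_i>Z_{n-k,n}s)$ and $\widehat T^1_n(s)=\frac1k\sum_{i=1}^nI(Z_i>Z_{n-k,n}s,\ \delta_i=1)$. The Extreme Nelson–Aalen and Extreme Kaplan–Meier estimators are, for $t\ge1$, $$\Lambda_{k,n}(t)=-\int_{(1,t]}\frac{1}{\widehat T_n(s-)}\,d\widehat T^1_n(s),\qquad F_{k,n}(t)=1-\prod_{1<s\le t}\big(1-\Delta\Lambda_{k,n}(s)\big),$$ the product being over the (finitely many) jump points of $\Lambda_{k,n}$ (product integral). They are considered on the event $\{Z_{n-k,n}>0\}$, whose probability tends to one. Limits: $\Lambda^\circ(s)=\frac1{\gamma_X}\log s$, $F^\circ(s)=1-s^{-1/\gamma_X}$, $s\ge1$. *)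

(* Defs.v *)
From HB Require Import structures.
From mathcomp Require Import all_boot all_order all_algebra.
From mathcomp Require Import all_classical all_reals all_analysis.
Set Implicit Arguments.
Unset Strict Implicit.
Unset Printing Implicit Defensive.
Import Order.TTheory GRing.Theory Num.Theory.
Import numFieldNormedType.Exports.
Local Open Scope classical_set_scope.
Local Open Scope ring_scope.

Section regular_variation_and_quantiles.
Context {R : realType}.

Definition slowly_varying (L : R -> R) : Prop :=
  forall x : R, 0 < x -> (L (t * x) / L t) @[t --> +oo] --> (1 : R).

(* The infimum is a real number when 0 < q < 1; elsewhere [inf] is total. *)
Definition quantile (F : R -> R) (q : R) : R := inf [set x | q <= F x].

End regular_variation_and_quantiles.

Section probability_notions.
Context {d : measure_display} {T : measurableType d} {R : realType}.
Variable P : probability T R.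

Definition mutually_independent (I : choiceType) (W : I -> {RV P >-> R}) : Prop :=
  forall (s : seq I) (B : I -> set R), uniq s ->
    (forall i, measurable (B i)) ->
    fine (P (\bigcap_(i in [set` s]) (W i @^-1` B i))) =
    \prod_(i <- s) fine (P (W i @^-1` B i)).

Definition dist_fun (Z : T -> R) (x : R) : R := fine (P [set w | Z w <= x]).

Definition cond_prob (E G : set T) : R := fine (P (E `&` G)) / fine (P G).

Definition cvg_in_prob0 (xi : nat -> T -> \bar R) : Prop :=
  forall eps : R, 0 < eps ->
    P [set w | (eps%:E < `|xi n w|)%E] @[n --> \oo] --> (0 : \bar R).

End probability_notions.

Section stieltjes.
Context {R : realType}.

Definition left_limit (f : R -> R) (s : R) : R := lim (f x @[x --> s^'-]).

Definition jump (f : R -> R) (s : R) : R := f s - left_limit f s.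

Definition is_cumulative (g : R -> R) : Prop :=
  nondecreasing g /\ right_continuous g.

Definition cumulative_of (g : R -> R) (hg : is_cumulative g) : cumulative R R :=
  HB.pack g (isCumulative.Build R _ R g (proj1 hg) (proj2 hg)).

(* Lebesgue-Stieltjes integral of f over D with respect to dg, with the
   conventional value 0 when g is not a (nondecreasing, right-continuous)
   integrator. *)
Definition stieltjes_integral (g : R -> R) (D : set R) (f : R -> R) : R :=
  if pselect (is_cumulative g) is left hg then
    Rintegral (lebesgue_stieltjes_measure (cumulative_of hg)) D f
  else 0.

Definition sup_dist (a b : R) (f g : R -> R) : \bar R :=
  ereal_sup [set `|f t - g t|%:E | t in `[a, b]].

End stieltjes.

(* Estimators computed from one realization z 0, ..., z n.-1 of the observed
   minima and b 0, ..., b n.-1 of the noncensoring indicators: observations are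
   indexed from 0, order statistics from 1. *)
Section estimators.
Context {R : realType}.
Variables (z : nat -> R) (b : nat -> bool).

(* z_{j,n}, the j-th smallest of n values, for 1 <= j <= n. *)
Definition order_stat (j n : nat) : R := nth 0 (sort <=%R (mkseq z n)) j.-1.

Definition That (k n : nat) (s : R) : R :=
  (k%:R)^-1 * \sum_(i < n) (order_stat (n - k) n * s < z i)%R%:R.

Definition That1 (k n : nat) (s : R) : R :=
  (k%:R)^-1 * \sum_(i < n) ((order_stat (n - k) n * s < z i)%R && b i)%:R.

(* The integrator is - That1: the leading minus sign of the definition is put
   on the integrator, since That1 is nonincreasing. When order_stat (n - k) n
   is positive, - That1 satisfies is_cumulative. When it is negative, - That1
   is nonincreasing and the integral gets its conventional value 0 (or is zero
   because That1 is constant). *)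
Definition nelson_aalen (k n : nat) (t : R) : R :=
  stieltjes_integral (fun s => - That1 k n s) `]1, t]
    (fun s => (left_limit (That k n) s)^-1).

(* The finitely supported product ranges exactly over the s in ]1, t] whose
   factor differs from 1, i.e. over the jump points of the step function
   nelson_aalen. *)
Definition kaplan_meier (k n : nat) (t : R) : R :=
  1 - \big[*%R/1]_(s \in `]1, t]) (1 - jump (nelson_aalen k n) s).

End estimators.

(* Main.v *)
Require Import Defs.
From HB Require Import structures.
From mathcomp Require Import all_boot all_order all_algebra.
From mathcomp Require Import all_classical all_reals all_analysis.
From mathcomp Require Import measurable_realfun ring lra zify.
Import Order.TTheory GRing.Theory Num.Theory.
Import numFieldNormedType.Exports.
Local Open Scope classical_set_scope.
Local Open Scope ring_scope.
Set Implicit Arguments.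
Unset Strict Implicit.
Unset Printing Implicit Defensive.

(** On {Z_{n-k,n} > 0} the Nelson-Aalen estimator is the finite sum of
    1 / #{j : Z_j >= Z_i} over the uncensored Z_i with v < Z_i <= v t, where
    v = Z_{n-k,n}.  With H(x) the same sum over u_n / 2 < Z_i <= u_n x, this is
    H(v t / u_n) - H(v / u_n).  The limit h(x) = (log x + log 2) / gamma_X of H
    satisfies h(v t / u_n) - h(v / u_n) = log t / gamma_X exactly, so uniform
    closeness of H to h suffices and v / u_n only has to stay in [1/2, 2].
    Uniform closeness is a Riemann-sum argument on a finite geometric grid: on
    a cell ]x, y] the increment of H lies between W / N(x) and W / N(y), where W
    counts the uncensored Z_i in ]u_n x, u_n y] and N(x) counts the Z_i above
    u_n x.  These finitely many counts obey a weak law (Chebyshev, pairwise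
    independence), their means being given by regular variation and by
    Condition 1.  For the Kaplan-Meier estimator, uniform closeness to a
    continuous limit forces small jumps, and then the product of the factors
    1 - jump is close to exp(- Nelson-Aalen).

    The set function P is unconstrained on non-measurable sets, so the events
    of the conclusion also have to be shown measurable; right-continuity of the
    estimators reduces the supremum to rational times. *)

(** * Independence of the pairs (X_i, Y_i) *)

Section independence.
Context {d d1 d2 : measure_display} {T : measurableType d}
  {U1 : measurableType d1} {U2 : measurableType d2} {R : realType}.

(** Rectangles are stable under intersection and generate the product sigma-algebra, so uniqueness
    of finite measures on a pi-system applies. *)
Lemma measure_prod_unique (m1 m2 : {measure set (U1 * U2) -> \bar R}) :
  (m1 setT < +oo)%E ->
  (forall A B, measurable A -> measurable B -> m1 (A `*` B) = m2 (A `*` B)) ->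
  forall C, measurable C -> m1 C = m2 C.
Proof.
move=> m1fin m12 C mC.
apply: (measure_unique [set A `*` B | A in measurable & B in measurable]
  (fun=> setT)) => //.
- exact: measurable_prod_measurableType.
- move=> _ _ [A mA [B mB <-]] [A' mA' [B' mB' <-]].
  exists (A `&` A'); first exact: measurableI.
  by exists (B `&` B'); [exact: measurableI|rewrite setXI].
- by move=> n; exists setT => //; exists setT => //; rewrite setXTT.
- by rewrite bigcup_const//; exists 0%N.
- by move=> _ [A mA [B mB <-]]; exact: m12.
Qed.

Variable P : probability T R.

(** Both sides are finite measures in [C], so rectangles decide. With [G = G' = setT] this transfers
    identity in law; with [G] an event of another pair, [G' = setT] and [c'] the probability of [G],
    it transfers independence. *)
Lemma prod_event_unique (c c' : {nonneg R}) (W W' : T -> U1 * U2) (G G' : set T) :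
  measurable_fun setT W -> measurable_fun setT W' ->
  measurable G -> measurable G' ->
  (forall A B, measurable A -> measurable B ->
    c%:num%:E * P (W @^-1` (A `*` B) `&` G) =
    c'%:num%:E * P (W' @^-1` (A `*` B) `&` G'))%E ->
  forall C, measurable C ->
    (c%:num%:E * P (W @^-1` C `&` G) = c'%:num%:E * P (W' @^-1` C `&` G'))%E.
Proof.
move=> mW mW' mG mG' rect C mC.
apply: (@measure_prod_unique (mscale c (pushforward (mrestr P mG) W))
  (mscale c' (pushforward (mrestr P mG') W'))) => //.
apply: lte_mul_pinfty => //.
by rewrite -ge0_fin_numE//; rewrite fin_num_measure// preimage_setT.
Qed.

End independence.

(** * Chebyshev's inequality for counts of pairwise independent events *)

Section counting_chebyshev.
Context {d : measure_display} {T : measurableType d} {R : realType}.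
Variable P : probability T R.
Local Open Scope ereal_scope.

Lemma Lfun2_indic (A : set T) : measurable A -> (\1_A : T -> R) \in Lfun P 2%:E.
Proof.
move=> mA; rewrite inE/=; apply/andP; split; rewrite inE/=.
  exact: measurable_indic.
rewrite /finite_norm unlock poweR_lty//.
rewrite (eq_integral (fun x => (\1_A x)%:E)); last first.
  move=> x _; rewrite /= !indicE; congr EFin.
  by case: (x \in A); rewrite ?normr1 ?powR1 ?normr0 ?powR0 ?pnatr_eq0.
by rewrite integral_indic// setIT -ge0_fin_numE// fin_num_measure.
Qed.

Lemma covariance_indic_indep (A B : set T) : measurable A -> measurable B ->
  P (A `&` B) = P A * P B -> covariance P \1_A \1_B = 0.
Proof.
move=> mA mB AB; have ? := Lfun2_indic mA; have ? := Lfun2_indic mB.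
have sub1 := Lfun_subset12 (fin_num_measure P _ measurableT).
rewrite covarianceE ?Lfun2_mul_Lfun1 ?sub1//.
rewrite (_ : (\1_A * \1_B)%R = \1_(A `&` B)); last by rewrite indicI.
rewrite !expectation_indic//; last exact: measurableI.
by rewrite AB subee// fin_numM// fin_num_measure.
Qed.

(** Pairwise independent indicators are uncorrelated, so the variance of the count is a sum of [n]
    terms [q - q ^+ 2], each at most [q]. *)
Lemma counting_chebyshev (E : nat -> set T) (q : R) n (eps : R) :
  (forall i, measurable (E i)) ->
  (forall i, P (E i) = q%:E) ->
  (forall i j, i != j -> P (E i `&` E j) = P (E i) * P (E j)) ->
  (0 < eps)%R ->
  P [set w | (eps <= `|\sum_(i < n) \1_(E i) w - n%:R * q|)%R] <=
    (n%:R * q / eps ^+ 2)%:E.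
Proof.
move=> mE Eq Eind eps0.
pose S m : T -> R := (\sum_(i < m) (\1_(E i) : T -> R))%R.
have Sw m w : S m w = (\sum_(i < m) \1_(E i) w)%R by rewrite /S fct_sumE.
have q0 : (0 <= q)%R by rewrite -lee_fin -(Eq 0%N).
have S2 m : S m \in Lfun P 2%:E.
  elim: m => [|m IH]; first by rewrite /S big_ord0 (Lfun_cst _ 0%R).
  have [_] := Lfun_addr_closed P (lee1n 2).
  by rewrite /S big_ord_recr; apply; [exact: IH|exact: Lfun2_indic].
have sub1 := Lfun_subset12 (fin_num_measure P _ measurableT).
have ES m : 'E_P[S m] = (m%:R * q)%:E.
  elim: m => [|m IH]; first by rewrite /S big_ord0 mul0r expectation_cst.
  rewrite /S big_ord_recr/= expectationD ?sub1 ?S2 ?Lfun2_indic// IH.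
  by rewrite expectation_indic// Eq -EFinD -natr1 mulrDl mul1r.
(* Indicators are added one at a time, so the only covariance to cancel is that of a partial sum
   with a later indicator. *)
have covS m j : (m <= j)%N -> covariance P (S m) \1_(E j) = 0.
  elim: m => [|m IH] mj; first by rewrite /S big_ord0 covariance_cst_l.
  rewrite /S big_ord_recr/= covarianceDl ?S2 ?Lfun2_indic// IH; last exact: ltnW.
  by rewrite covariance_indic_indep ?add0e// Eind// ltn_eqF.
have VS m : 'V_P[S m] <= (m%:R * q)%:E.
  elim: m => [|m IH]; first by rewrite /S big_ord0 mul0r variance_cst.
  rewrite /S big_ord_recr/= varianceD ?S2 ?Lfun2_indic// covS// mule0 adde0.
  rewrite -natr1 mulrDl mul1r EFinD; apply: leeD => //.
  rewrite varianceE ?Lfun2_indic//.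
  rewrite (_ : (\1_(E m) ^+ 2)%R = \1_(E m)); last first.
    by rewrite -[in RHS](setIid (E m)) indicI.
  rewrite expectation_indic// Eq -EFin_expe -EFinB lee_fin.
  by rewrite gerBl sqr_ge0.
have mS : measurable_fun setT (S n).
  by have := S2 n; rewrite inE => /andP[]; rewrite inE.
pose SX : {RV P >-> R} := HB.pack (S n) (isMeasurableFun.Build _ _ _ _ _ mS).
have := chebyshev SX eps0; rewrite /= ES/= => h.
under eq_set do rewrite -Sw.
apply: (le_trans h).
rewrite muleC EFinM; apply: lee_wpmul2r; last exact: VS.
by rewrite lee_fin invr_ge0 sqr_ge0.
Qed.

End counting_chebyshev.

(** The open rays to the right form a pi-system generating the Borel sets, and their masses are read
    off the cdf by complementation. *)
Lemma eq_cdf_law (d : measure_display) (T : measurableType d) (R : realType)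
    (P : probability T R) (X X' : {RV P >-> R}) :
  (forall x, cdf X x = cdf X' x) ->
  forall A, measurable A -> P (X @^-1` A) = P (X' @^-1` A).
Proof.
move=> cdfE A mA.
have := @measure_unique _ R _ (@RGenOInfty.G R)
  (fun n => `](- n%:R), +oo[%classic) _ _ _ _ (distribution P X) (distribution P X').
apply => //.
- exact: RGenOInfty.measurableE.
- move=> _ _ [x ->] [y ->]; exists (Num.max x y).
  by apply/seteqP; split=> t /=; rewrite !in_itv/= !andbT gt_max => /andP.
- by move=> n; exists (- n%:R).
- rewrite -subTset => x _; exists (Num.bound x) => //=.
  by rewrite in_itv/= andbT ltrNl unstable.ltrNbound.
- move=> _ [x ->]; rewrite -setCitvl /= /distribution /pushforward !preimage_setC.
  have mpre (V : {RV P >-> R}) : measurable (V @^-1` `]-oo, x]).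
    by rewrite -[X in measurable X]setTI; exact: measurable_funP.
  rewrite !probability_setC; [congr (_ - _)%E; exact: cdfE|exact: mpre|exact: mpre].
- by move=> n; rewrite -ge0_fin_numE// fin_num_measure.
Qed.

(** * Identical law and pairwise independence of the pairs *)

Section independent_pairs.
Context {d : measure_display} {T : measurableType d} {R : realType}.
Variable P : probability T R.
Variables (X Y : nat -> {RV P >-> R}).
Hypothesis hindep : mutually_independent
    (fun i : nat + nat => match i with inl j => X j | inr j => Y j end).
Hypotheses (hX : forall i x, cdf (X i) x = cdf (X 0%N) x)
  (hY : forall i x, cdf (Y i) x = cdf (Y 0%N) x).
Local Open Scope ereal_scope.

Let W i w := (X i w, Y i w).

Lemma measurable_pair_RV i : measurable_fun setT (W i).
Proof. exact: measurable_fun_pair. Qed.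

Lemma RV_preimage (V : {RV P >-> R}) A : measurable A -> measurable (V @^-1` A).
Proof. by move=> mA; rewrite -[X in measurable X]setTI; exact: measurable_funP. Qed.

Lemma pair_rect i A B : measurable A -> measurable B ->
  P (W i @^-1` (A `*` B)) = P (X i @^-1` A) * P (Y i @^-1` B).
Proof.
move=> mA mB.
have := @hindep [:: inl i; inr i]
  (fun s => match s with inl _ => A | inr _ => B end) erefl.
rewrite big_cons big_seq1/= => h.
have mXA := @RV_preimage (X i) _ mA; have mYB := @RV_preimage (Y i) _ mB.
rewrite -(fineK (fin_num_measure P _ mXA)) -(fineK (fin_num_measure P _ mYB)).
rewrite -EFinM -h; last by case.
rewrite (_ : \bigcap_(_ in _) _ = X i @^-1` A `&` Y i @^-1` B).
  by rewrite fineK// fin_num_measure//; exact: measurableI.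
apply/seteqP; split => w /=.
  by move=> h2; split; [apply: (h2 (inl i))|apply: (h2 (inr i))];
    rewrite /= !inE eqxx ?orbT.
by move=> [Aw Bw] s; rewrite /= !inE => /orP[] /eqP ->.
Qed.

Lemma pair_rect2 i j A B A' B' : i != j ->
  measurable A -> measurable B -> measurable A' -> measurable B' ->
  P (W i @^-1` (A `*` B) `&` W j @^-1` (A' `*` B')) =
  P (W i @^-1` (A `*` B)) * P (W j @^-1` (A' `*` B')).
Proof.
move=> ij mA mB mA' mB'.
(* Independence is used at four indices; since [i != j], the test [l == i] assigns to each pair its
   own sets. *)
have := @hindep [:: inl i; inr i; inl j; inr j]
  (fun s => match s with inl l => if l == i then A else A'
                       | inr l => if l == i then B else B' end).
rewrite !big_cons big_nil/= !eqxx eq_sym (negbTE ij) mulr1 !inE/= => h.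
have mXA := @RV_preimage (X i) _ mA; have mYB := @RV_preimage (Y i) _ mB.
have mXA' := @RV_preimage (X j) _ mA'; have mYB' := @RV_preimage (Y j) _ mB'.
rewrite !pair_rect//.
rewrite -(fineK (fin_num_measure P _ mXA)) -(fineK (fin_num_measure P _ mYB)).
rewrite -(fineK (fin_num_measure P _ mXA')) -(fineK (fin_num_measure P _ mYB')).
rewrite -!EFinM -mulrA -h; last first.
- by case=> l; case: ifP.
- by apply/and3P; split => //; apply/norP; split.
rewrite (_ : \bigcap_(_ in _) _ = W i @^-1` (A `*` B) `&` W j @^-1` (A' `*` B')).
  rewrite fineK// fin_num_measure//.
  by do !apply: measurableI.
apply/seteqP; split => w /=.
  move=> h2; have ji : (j == i) = false by rewrite eq_sym (negbTE ij).
  have := h2 (inl i); rewrite /= !inE !eqxx => /(_ erefl) ?.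
  have := h2 (inr i); rewrite /= !inE !eqxx orbT => /(_ erefl) ?.
  have := h2 (inl j); rewrite /= !inE ji !eqxx !orbT => /(_ erefl) ?.
  by have := h2 (inr j); rewrite /= !inE ji !eqxx !orbT => /(_ erefl) ?; do !split.
move=> [[Aw Bw] [Aw' Bw']] s; rewrite /= !inE.
by move=> /or4P[] /eqP -> /=; rewrite ?eqxx// eq_sym (negbTE ij).
Qed.

Lemma pair_ident i C : measurable C -> P (W i @^-1` C) = P (W 0%N @^-1` C).
Proof.
move=> mC.
have := @prod_event_unique _ _ _ _ _ _ R P (1%:nng)%R (1%:nng)%R (W i) (W 0%N) setT setT
  (measurable_pair_RV i) (measurable_pair_RV 0) measurableT measurableT _ C mC.
rewrite /= !mul1e !setIT => -> // A B mA mB; rewrite !mul1e !setIT !pair_rect//.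
by congr (_ * _); exact: eq_cdf_law.
Qed.

Lemma measurable_pair_event i C : measurable C -> measurable (W i @^-1` C).
Proof.
by move=> mC; rewrite -[X in measurable X]setTI; exact: measurable_pair_RV.
Qed.

(** Rectangles are replaced one side at a time: first [C] becomes arbitrary against a rectangle for
    [W j] ([rectl]), then [C'] against that fixed [C]. *)
Lemma pair_indep i j C C' : i != j -> measurable C -> measurable C' ->
  P (W i @^-1` C `&` W j @^-1` C') = P (W i @^-1` C) * P (W j @^-1` C').
Proof.
move=> ij mC mC'.
have pnng (E : set T) : measurable E -> {c : {nonneg R} | P E = (c%:num)%:E}.
  move=> mE; have fE0 : (0 <= fine (P E))%R by rewrite fine_ge0.
  by exists (NngNum fE0); rewrite /= fineK// fin_num_measure.
have rectl A B : measurable A -> measurable B ->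
    P (W i @^-1` C `&` W j @^-1` (A `*` B)) =
    P (W i @^-1` C) * P (W j @^-1` (A `*` B)).
  move=> mA mB; have mABj : measurable (W j @^-1` (A `*` B)).
    by apply: measurable_pair_event; exact: measurableX.
  have [c cE] := pnng _ mABj.
  have := @prod_event_unique _ _ _ _ _ _ R P (1%:nng)%R c (W i) (W i) (W j @^-1` (A `*` B))
    setT (measurable_pair_RV i) (measurable_pair_RV i) mABj measurableT _ C mC.
  rewrite /= mul1e setIT -cE muleC => -> // A' B' mA' mB'.
  by rewrite mul1e setIT muleC pair_rect2.
have mCi := measurable_pair_event i mC.
have [c cE] := pnng _ mCi.
have := @prod_event_unique _ _ _ _ _ _ R P (1%:nng)%R c (W j) (W j) (W i @^-1` C)
    setT (measurable_pair_RV j) (measurable_pair_RV j) mCi measurableT _ C' mC'.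
rewrite /= mul1e setIT -cE setIC => -> // A' B' mA' mB'.
by rewrite mul1e setIT setIC rectl.
Qed.

End independent_pairs.

(** * The estimators of one sample *)

Lemma lebesgue_stieltjes_measure_itv (R : realType) (f : cumulative R R) (x y : R) :
  x <= y -> lebesgue_stieltjes_measure f `]x, y]%classic = (f y - f x)%:E.
Proof.
move=> xy; rewrite /lebesgue_stieltjes_measure /measure_extension/=.
by rewrite measurable_mu_extE/= ?wlength_itv_bnd//; exact: is_ocitv.
Qed.

Section nelson_aalen_formula.
Context {R : realType}.
Variables (z : nat -> R) (b : nat -> bool) (k n : nat).
Hypothesis k0 : (0 < k)%N.

(** When [v], the order statistic, is positive, this is [k] times the left limit of [That] at
    [x / v]; taking the left limit makes the inequality weak. *)
Definition at_risk (x : R) : R := \sum_(j < n) (x <= z j)%R%:R.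

Definition na_sum (v t : R) : R :=
  \sum_(i < n) ((v < z i <= v * t) && b i)%:R / at_risk (z i).

Let v := order_stat z (n - k) n.

Lemma at_risk_ge0 x : 0 <= at_risk x.
Proof. by apply: sumr_ge0 => i _; exact: ler0n. Qed.

Lemma at_risk_mono x y : x <= y -> at_risk y <= at_risk x.
Proof.
move=> xy; apply: ler_sum => i _; rewrite ler_nat.
by case: (leP y (z i)) => // /(le_trans xy) ->.
Qed.

(** For [x] just below [s], the strict [v * x < z i] amounts to [v * s <= z i], simultaneously for
    the finitely many [i]. *)
Lemma left_limit_That s : 0 < v -> left_limit (That z k n) s = k%:R^-1 * at_risk (v * s).
Proof.
move=> v0; apply: norm_lim_near_cst.
have : \forall x \near s^'-, forall i : 'I_n, (v * x < z i) = (v * s <= z i).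
  apply: filter_forall => i; case: (leP (v * s) (z i)) => [vsz|zvs].
    by near=> x; apply: (lt_le_trans _ vsz); rewrite ltr_pM2l.
  near=> x; apply/negbTE; rewrite -leNgt ltW// mulrC -ltr_pdivrMr//.
  by near: x; apply: nbhs_left_gt; rewrite ltr_pdivrMr// mulrC.
apply: filterS => x hx; rewrite /That; congr (_ * _).
by apply: eq_bigr => i _; rewrite hx.
Unshelve. all: by end_near. Qed.

Let g s := - That1 z b k n s.

Lemma That1_is_cumulative : 0 < v -> is_cumulative g.
Proof.
move=> v0; split.
  move=> x y xy; rewrite /g lerN2 /That1 ler_wpM2l ?invr_ge0//.
  apply: ler_sum => i _; rewrite ler_nat -/v.
  case: (b i); rewrite ?andbF// !andbT.
  case: (ltP (v * y) (z i)) => // vyz.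
  by rewrite (le_lt_trans _ vyz)// ler_pM2l.
move=> s; apply: cvg_near_cst.
have : \forall x \near s^'+, forall i : 'I_n, (v * x < z i) = (v * s < z i).
  apply: filter_forall => i; case: (ltP (v * s) (z i)) => [vsz|zvs].
    near=> x; rewrite mulrC -ltr_pdivlMr//.
    by near: x; apply: nbhs_right_lt; rewrite ltr_pdivlMr// mulrC.
  by near=> x; apply/negbTE; rewrite -leNgt (le_trans zvs)// ler_pM2l// ltW.
apply: filterS => x hx; rewrite /g /That1; congr (- (_ * _)).
by apply: eq_bigr => i _; rewrite -/v hx.
Unshelve. all: by end_near. Qed.

(** The measure of [- That1] in atomic form: each uncensored observation puts mass 1/k at
    [z i / v]. *)
Let jumps : {measure set (measurableTypeR R) -> \bar R} :=
  mscale (k%:R^-1)%:nng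
    (msum (fun i => mscale (b i)%:R%:nng (dirac (z i / v : measurableTypeR R))) n).

Lemma lebesgue_stieltjes_That1 (hg : is_cumulative g) A : 0 < v -> measurable A ->
  lebesgue_stieltjes_measure (cumulative_of hg) A = jumps A.
Proof.
move=> v0; apply: lebesgue_stieltjes_measure_unique => _ [[x y] _ <-].
have [yx|xy] := ltP y x.
  by rewrite set_itv_ge ?measure0// bnd_simp -leNgt ltW.
rewrite lebesgue_stieltjes_measure_itv//= /mscale /msum/= /g /That1 -/v opprK addrC -mulrBr -sumrB.
rewrite EFinM; congr (_ * _)%E; rewrite -sumEFin; apply: eq_bigr => i _.
have dE : dirac (z i / v : measurableTypeR R) `]x, y]%classic =
    ((v * x < z i <= v * y)%R%:R)%:E :> \bar R.
  rewrite /dirac indicE; congr ((nat_of_bool _)%:R%:E); apply/idP/idP; rewrite inE/= in_itv/=;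
  by rewrite ltr_pdivlMr// ler_pdivrMr// ![_ * v]mulrC.
apply: etrans (congr1 (fun e => ((b i)%:R)%:E * e)%E (esym dE)).
rewrite -EFinM; congr EFin.
have [vyz|zvy] := ltP (v * y) (z i).
  by rewrite (le_lt_trans _ vyz) ?ler_pM2l//= subrr mulr0.
by rewrite andbT/= subr0 -natrM mulnb andbC.
Qed.

(** Integration against point masses leaves a finite sum, and the factor 1/k of each mass cancels
    the one in the left limit of [That]. *)
Lemma nelson_aalenE t : 0 < v -> nelson_aalen z b k n t = na_sum v t.
Proof.
move=> v0; rewrite /nelson_aalen /stieltjes_integral.
case: pselect => [hg|]; last by have := That1_is_cumulative v0.
pose f s := (k%:R^-1 * at_risk (v * s))^-1.
rewrite (_ : (fun s => (left_limit (That z k n) s)^-1) = f); last first.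
  by apply/funext => s; rewrite left_limit_That.
have f0 s : 0 <= f s by rewrite invr_ge0 mulr_ge0 ?invr_ge0// at_risk_ge0.
have mf (D : set R) : measurable D -> measurable_fun D (fun s : R => (f s)%:E).
  move=> mD; apply/measurable_EFinP.
  (* Inversion is written as the power -1, known to be measurable; the two agree on nonnegative
     reals, 0 included. *)
  rewrite (_ : f = (@powR R ^~ (-1)) \o (fun s => k%:R^-1 * at_risk (v * s))).
    apply: (measurableT_comp (measurable_powR _)).
    apply: nonincreasing_measurable => // x y xy.
    by rewrite ler_wpM2l ?invr_ge0// at_risk_mono// ler_pM2l.
  apply/funext => s; rewrite /= powR_inv1// mulr_ge0 ?invr_ge0//.
  exact: at_risk_ge0.
rewrite /Rintegral (eq_measure_integral jumps); last first.
  by move=> A mA _; exact: lebesgue_stieltjes_That1.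
have mD : measurable (`]1, t]%classic : set (measurableTypeR R)) by exact: measurable_itv.
rewrite ge0_integral_mscale//=; last 2 first.
- exact: mf.
- by move=> x _; rewrite lee_fin.
rewrite ge0_integral_measure_sum//=; last 2 first.
- by move=> x _; rewrite lee_fin.
- exact: mf.
rewrite (eq_bigr (fun i : 'I_n => (((1 < z i / v <= t) && b i)%:R * f (z i / v))%:E)); last first.
  move=> i _; rewrite ge0_integral_mscale//=; last 2 first.
  - exact: mf.
  - by move=> x _; rewrite lee_fin.
  rewrite integral_dirac//; last exact: mf.
  rewrite diracE -!EFinM; congr EFin; rewrite mulrA -natrM mulnb andbC.
  congr (((_ && _)%:R) * _); apply/idP/idP; rewrite inE/= in_itv/=//.
rewrite sumEFin -EFinM/= mulr_sumr; apply: eq_bigr => i _.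
rewrite /f (_ : v * (z i / v) = z i); last by rewrite mulrC divfK ?gt_eqF.
rewrite invfM invrK mulrCA [k%:R^-1 * _]mulrA mulVf ?pnatr_eq0 -?lt0n// mul1r.
by rewrite ltr_pdivlMr// mul1r ler_pdivrMr// [t * v]mulrC.
Qed.

(** Here [- That1] is nonincreasing, so if it is an integrator at all it is constant and its measure
    vanishes. The value is needed for measurability on the whole space. *)
Lemma nelson_aalen_le0 t : v <= 0 -> nelson_aalen z b k n t = 0.
Proof.
move=> v0; rewrite /nelson_aalen /stieltjes_integral.
case: pselect => // hg.
have gcst x y : g x = g y.
  suff gle x' y' : x' <= y' -> g x' = g y'.
    by case: (leP x y) => [|/ltW] /gle.
  move=> xy; apply/eqP; rewrite eq_le (proj1 hg)//= /g lerN2 /That1 -/v.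
  rewrite ler_wpM2l ?invr_ge0//; apply: ler_sum => i _; rewrite ler_nat.
  case: (b i); rewrite ?andbF// !andbT.
  case: (ltP (v * x') (z i)) => // vxz.
  by rewrite (le_lt_trans _ vxz)// ler_wnM2l.
rewrite /Rintegral (eq_measure_integral mzero) ?integral_measure_zero//.
move=> A mA _; apply: lebesgue_stieltjes_measure_unique => // _ [[x y] _ <-].
have [yx|xy] := ltP y x.
  by rewrite set_itv_ge ?measure0// bnd_simp -leNgt ltW.
by rewrite lebesgue_stieltjes_measure_itv//= -!/(g _) (gcst y x) subrr.
Qed.

End nelson_aalen_formula.

(** For [x <= y] the difference is [expR (- x) * (1 - expR (x - y))], bounded through
    [expR (- x) <= 1] and [1 + (x - y) <= expR (x - y)]. *)
Lemma expRN_lipschitz (R : realType) (x y : R) : 0 <= x -> 0 <= y ->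
  `|expR (- x) - expR (- y)| <= `|x - y|.
Proof.
wlog xy : x y / x <= y.
  move=> h x0 y0; case: (leP x y) => [/h|/ltW/h]; first exact.
  by move=> h1; rewrite distrC (distrC x); exact: h1.
move=> x0 y0; rewrite ger0_norm ?subr_ge0 ?ler_expR ?lerN2//.
rewrite distrC ger0_norm ?subr_ge0//.
have := expR_ge1Dx (x - y).
rewrite (_ : expR (- y) = expR (- x) * expR (x - y)); last first.
  by rewrite -expRD addrA addNr add0r.
have : expR (- x) <= 1 by rewrite -expR0 ler_expR oppr_le0.
have := expR_gt0 (- x); have : expR (x - y) <= 1 by rewrite -expR0 ler_expR subr_le0.
move: (expR _) (expR _) => e e' ? ? ? ?; nra.
Qed.

(** * The Kaplan-Meier estimator as a finite product *)

Section kaplan_meier_formula.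
Context {R : realType}.
Variables (z : nat -> R) (b : nat -> bool) (k n : nat).
Hypothesis k0 : (0 < k)%N.

Local Notation at_risk := (at_risk z n).
Local Notation na_sum := (na_sum z b n).

Definition jump_at (x : R) : R :=
  \sum_(i < n) ((z i == x) && b i)%:R / at_risk (z i).

(* Ties: a product over the distinct observed values is written as a product
   over the indices at which a value appears for the first time. *)
Definition first_index (i : 'I_n) : bool :=
  [forall j : 'I_n, (j < i)%N ==> (z j != z i)].

Definition km_prod (v t : R) : R :=
  \prod_(i < n | first_index i && (v < z i <= v * t)) (1 - jump_at (z i)).

Lemma first_index_inj (i j : 'I_n) :
  first_index i -> first_index j -> z i = z j -> i = j.
Proof.
move=> /forallP fi /forallP fj zij; apply/val_inj/eqP.
rewrite eqn_leq; apply/andP; split; rewrite leqNgt; apply/negP => h.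
  by have := fi j; rewrite h zij eqxx.
by have := fj i; rewrite h zij eqxx.
Qed.

Lemma first_index_ex (i : 'I_n) : {j : 'I_n | first_index j & z j = z i}.
Proof.
case: (@arg_minnP _ i (fun j : 'I_n => z j == z i) val (eqxx _)) => j /eqP zj jmin.
exists j => //; apply/forallP => l; apply/implyP => lj.
apply/eqP => zl; have := jmin l; rewrite zl zj eqxx => /(_ erefl).
by rewrite leqNgt lj.
Qed.

Lemma jump_at_ge0 x : 0 <= jump_at x.
Proof. by apply: sumr_ge0 => i _; rewrite divr_ge0// at_risk_ge0. Qed.

(** Tied observations are grouped, each group being collected at its first index. *)
Lemma na_sum_first v t :
  na_sum v t = \sum_(i < n | first_index i && (v < z i <= v * t)) jump_at (z i).
Proof.
pose p i := s2val (first_index_ex i).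
have fp i : first_index (p i) := s2valP (first_index_ex i).
have zp i : z (p i) = z i := s2valP' (first_index_ex i).
transitivity (\sum_(i < n | v < z i <= v * t) (b i)%:R / at_risk (z i)).
  rewrite /na_sum [RHS]big_mkcond; apply: eq_bigr => i _.
  by case: ifP => // _; rewrite mul0r.
rewrite (partition_big p (fun i => first_index i && (v < z i <= v * t))); last first.
  by move=> i vzt; rewrite fp zp.
apply: eq_bigr => j /andP[fj vzt].
rewrite /jump_at [RHS]big_mkcond/= [LHS]big_mkcond/=; apply: eq_bigr => i _.
have -> : (p i == j) = (z i == z j).
  apply/eqP/eqP => [<-//|zij]; apply: first_index_inj => //.
  by rewrite zp.
case: eqVneq => [->|_]; first by rewrite vzt.
by rewrite andbF mul0r.
Qed.

(** Observations equal to [v * s] are disjoint from those up to [v * x], and both kinds are counted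
    up to [v * s]. A jump is thus bounded by an increment, which uniform closeness controls. *)
Lemma na_sum_jump v x s : 0 < v -> 1 <= x -> x < s ->
  na_sum v x + jump_at (v * s) <= na_sum v s.
Proof.
move=> v0 x1 xs; rewrite -big_split/=; apply: ler_sum => i _.
rewrite -mulrDl ler_wpM2r ?invr_ge0 ?at_risk_ge0//.
rewrite -natrD ler_nat; case: (b i); rewrite ?andbF// !andbT.
case: eqVneq => [->|_].
  by rewrite lexx andbT [v * s <= _]leNgt ltr_pM2l// xs andbF ltr_pMr// (le_lt_trans x1).
rewrite addn0; case/boolP: (v < z i <= v * x) => // /andP[-> zvx].
by rewrite (le_trans zvx)// ler_pM2l// ltW.
Qed.

Let v := order_stat z (n - k) n.

Lemma jump_nelson_aalen s : 0 < v -> 1 < s ->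
  jump (nelson_aalen z b k n) s = jump_at (v * s).
Proof.
move=> v0 s1; rewrite /jump.
have -> : left_limit (nelson_aalen z b k n) s =
    \sum_(i < n) ((v < z i < v * s) && b i)%:R / at_risk (z i).
  apply: norm_lim_near_cst.
  have : \forall x \near s^'-, forall i : 'I_n, (z i <= v * x) = (z i < v * s).
    apply: filter_forall => i; case: (ltP (z i) (v * s)) => [zvs|vsz].
      near=> x; rewrite mulrC -ler_pdivrMr// ltW//.
      by near: x; apply: nbhs_left_gt; rewrite ltr_pdivrMr// mulrC.
    by near=> x; apply/negbTE; rewrite -ltNge (lt_le_trans _ vsz)// ltr_pM2l.
  apply: filterS => x hx; rewrite nelson_aalenE// /na_sum.
  by apply: eq_bigr => i _; rewrite hx.
rewrite nelson_aalenE// /na_sum -sumrB; apply: eq_bigr => i _.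
rewrite -mulrBl; congr (_ / _); case: (b i); rewrite ?andbF ?subrr// !andbT.
rewrite -/v; case: (ltgtP (z i) (v * s)) => [_|_|->]; rewrite ?andbT ?andbF ?subrr//.
by rewrite ltr_pMr// s1 subr0.
Unshelve. all: by end_near. Qed.

Lemma kaplan_meierE t : 0 < v -> kaplan_meier z b k n t = 1 - km_prod v t.
Proof.
move=> v0; rewrite /kaplan_meier; congr (1 - _).
pose D := [pred i : 'I_n | first_index i && (v < z i <= v * t)].
(* The possible jump points in []1, t]], without repetition: at any other [s] no observation equals
   [v * s], so the factor is 1. *)
pose r := [seq z (val i) / v | i <- enum D].
have rP (i : 'I_n) : D i -> z i / v \in `]1, t].
  by move=> /andP[_]; rewrite in_itv/= ltr_pdivlMr// mul1r ler_pdivrMr// [t * v]mulrC.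
rewrite (@fsbigE _ _ _ _ _ r); last 3 first.
- rewrite map_inj_in_uniq ?enum_uniq// => i j; rewrite !mem_enum => /andP[fi _] /andP[fj _].
  by move=> /(mulIf _) zij; apply: first_index_inj => //; apply: zij; rewrite invr_eq0 gt_eqF.
- by move=> s /= /mapP[i]; rewrite mem_enum => Di ->; exact: rP.
- move=> s /= st sr; rewrite jump_nelson_aalen//; last by move: st; rewrite in_itv => /andP[].
  rewrite /jump_at big1 ?subr0// => i _; case: eqVneq; last by rewrite mul0r.
  move=> zi; exfalso; move/negP: sr; apply; apply/mapP.
  have [j fj zj] := first_index_ex i.
  exists j; last by rewrite zj zi mulrC mulKf// gt_eqF.
  rewrite mem_enum; apply/andP; split; rewrite // zj zi ltr_pMr// ler_pM2l//.
rewrite big_map big_enum_cond/=; apply: eq_big => [i|i].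
  rewrite !inE; apply: andb_idr => Di; rewrite inE; exact: rP.
move=> /andP[Di _]; have := rP _ Di; rewrite in_itv/= => /andP[zi1 _].
by rewrite jump_nelson_aalen// mulrC divfK// gt_eqF.
Qed.

Lemma kaplan_meier_le0 t : v <= 0 -> kaplan_meier z b k n t = 0.
Proof.
move=> v0; rewrite /kaplan_meier fsbig1 ?subrr// => s _.
rewrite /jump /left_limit.
rewrite (_ : nelson_aalen z b k n = cst 0); last first.
  by apply/funext => x; rewrite nelson_aalen_le0.
by rewrite lim_cst ?subr0//; exact: norm_hausdorff.
Qed.

(** Closeness to the continuous [c * ln t] forces every jump [x] to satisfy [x <= 2 * eps]. Each
    factor [1 - x] then lies between [expR (- ((1 + 4 * eps) * x))] and [expR (- x)], and the
    products of these bounds are exponentials of [na_sum]. *)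
Lemma km_prod_close (c A eps : R) : 0 < v -> 0 <= c -> 0 < eps -> eps <= 4^-1 ->
  (forall t, 1 <= t <= A -> `|na_sum v t - c * ln t| <= eps) ->
  forall t, 1 <= t <= A ->
    `|km_prod v t - t `^ (- c)| <= eps * (4 * c * ln A + 2).
Proof.
move=> v0 c0 e0 e4 close t /andP[t1 tA].
have jump_le s : 1 < s <= A -> jump_at (v * s) <= 2 * eps.
  move=> /andP[s1 sA]; apply/ler_addgt0Pr => e e_gt0.
  (* A point of [[1, s[] so near [s] that [c * ln] varies by at most [e]; [c + 1] avoids dividing by
     zero when [c] is 0. *)
  pose x := Num.max 1 (s - e / (c + 1)).
  have x1 : 1 <= x by rewrite le_max lexx.
  have c1 : 0 < c + 1 by rewrite ltr_wpDl.
  have xs : x < s by rewrite gt_max s1/= gtrBl divr_gt0.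
  have x0 : 0 < x by rewrite (lt_le_trans _ x1).
  have s0 : 0 < s by rewrite (lt_trans x0).
  have lnsx : ln s - ln x <= s - x.
    rewrite -ln_div ?posrE//; apply: (@le_trans _ _ (s / x - 1)).
      rewrite -[X in ln X](subrKC 1); apply: le_ln1Dx.
      by rewrite ltrBrDr addNr divr_gt0.
    rewrite (_ : s / x - 1 = (s - x) / x); last by rewrite mulrBl divff ?gt_eqF.
    by rewrite ler_pdivrMr// ler_peMr// subr_ge0 ltW.
  have := close s; rewrite (ltW s1) sA => /(_ erefl); rewrite ler_norml => /andP[_ hs].
  have := close x; rewrite x1 (le_trans (ltW xs))// => /(_ erefl).
  rewrite ler_norml => /andP[hx _].
  have hj := na_sum_jump v0 x1 xs.
  have : c * (ln s - ln x) <= e.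
    apply: (@le_trans _ _ (c * (s - x))); first by rewrite ler_wpM2l.
    apply: (@le_trans _ _ (c * (e / (c + 1)))).
      rewrite ler_wpM2l// lerBlDr -lerBlDl.
      by rewrite /x le_max lexx orbT.
    rewrite mulrA ler_pdivrMr// mulrC ler_wpM2l ?(ltW e_gt0)//.
    by rewrite lerDl.
  lra.
pose D (i : 'I_n) := first_index i && (v < z i <= v * t).
have J0 i : 0 <= jump_at (z i) := jump_at_ge0 (z i).
have J2 i : D i -> jump_at (z i) <= 2 * eps.
  move=> /andP[_ /andP[vz zt]].
  rewrite (_ : z i = v * (z i / v)); last by rewrite mulrC divfK// gt_eqF.
  apply: jump_le; rewrite ltr_pdivlMr// mul1r vz/= ler_pdivrMr// mulrC.
  by rewrite (le_trans zt)// ler_pM2l.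
have LE : na_sum v t = \sum_(i < n | D i) jump_at (z i) := na_sum_first v t.
have prodE q : \prod_(i < n | D i) expR (- (q * jump_at (z i))) = expR (- (q * na_sum v t)).
  by rewrite -expR_sum LE mulr_sumr sumrN.
have up : km_prod v t <= expR (- na_sum v t).
  rewrite -[na_sum v t]mul1r -prodE; apply: ler_prod => i Di.
  rewrite mul1r (le_trans _ (expR_ge1Dx _))// andbT.
  by rewrite subr_ge0 (le_trans (J2 _ Di))//; lra.
(* Using [expR y >= 1 + y], it suffices that [(1 + (1 + 4 * eps) * x) * (1 - x) >= 1], which holds
   for [x <= 2 * eps] exactly because [eps <= 1/4]. *)
have low : expR (- ((1 + 4 * eps) * na_sum v t)) <= km_prod v t.
  rewrite -prodE; apply: ler_prod => i Di; rewrite expR_ge0/= expRN.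
  have := J2 _ Di; have := J0 i; move: (jump_at (z i)) => x x0 x2.
  have x1 : 0 < 1 - x by lra.
  rewrite -[leRHS]invrK lef_pV2 ?posrE ?expR_gt0 ?invr_gt0//.
  rewrite (le_trans _ (expR_ge1Dx _))// -div1r ler_pdivrMr//.
  by nra.
have L0 : 0 <= na_sum v t by rewrite LE sumr_ge0.
have ln0 : 0 <= ln t by rewrite ln_ge0.
have lnA : ln t <= ln A by rewrite ler_ln ?posrE ?(lt_le_trans ltr01)// (le_trans t1).
rewrite /powR gt_eqF ?(lt_le_trans ltr01)// mulNr.
have := close t; rewrite t1 tA => /(_ erefl).
move=> Lclose.
have d2 := le_trans (expRN_lipschitz L0 (mulr_ge0 c0 ln0)) Lclose.
have L1 : 0 <= (1 + 4 * eps) * na_sum v t by rewrite mulr_ge0//; lra.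
have := expRN_lipschitz L1 L0.
rewrite (_ : (1 + 4 * eps) * na_sum v t - na_sum v t = 4 * eps * na_sum v t); last by ring.
rewrite (ger0_norm (_ : 0 <= 4 * eps * _)); last by rewrite !mulr_ge0// ltW.
move=> d1.
(* The total error is [4 * eps * na_sum v t] for the product plus [eps] for the exponent;
   [4 * eps * eps <= eps] then gives the constant of the statement. *)
have LA : 4 * eps * na_sum v t <= 4 * eps * (c * ln A + eps).
  have := ler_wpM2l c0 lnA; move: Lclose; rewrite ler_norml => /andP[_ ? ?].
  by rewrite ler_wpM2l ?mulr_ge0 ?(ltW e0)//; lra.
have e2 : 4 * eps * eps <= eps by rewrite ler_piMl ?(ltW e0)//; lra.
have cA0 : 0 <= c * ln A by rewrite mulr_ge0// (le_trans ln0).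
move: d1 d2; rewrite !ler_norml => /andP[d1 _] /andP[d2 d3].
have bnd : eps * (4 * c * ln A + 2) = 4 * eps * (c * ln A) + 2 * eps by ring.
have : 0 <= 4 * eps * (c * ln A) by rewrite mulr_ge0// mulr_ge0// ltW.
rewrite bnd; move: LA; rewrite mulrDr => LA ?.
by apply/andP; split; lra.
Qed.

End kaplan_meier_formula.

(** * Riemann sums for the Nelson-Aalen estimator *)

(** [N0] and [N1] stand for the exceedances of the left and right ends of a cell, [W] for its
    uncensored points. The ideal ratios [p * (E - 1) / E] and [p * (E - 1)] are within a factor [E]
    of [p * th]; the relative errors [eta] cost the factor [(1 + eta) / (1 - eta)]. *)
Lemma cell_ratio_bounds (R : realType) (p th E eta S N0 N1 W : R) :
  0 < p -> 0 < th -> 1 + th <= E -> E - 1 <= E * th -> 0 < eta -> eta < 1 -> 0 < S ->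
  `|N0 - S * E| <= eta * (S * E) -> `|N1 - S| <= eta * S ->
  `|W - p * (S * E - S)| <= eta * (p * (S * E - S)) ->
  let sigma := (1 + eta) / (1 - eta) * E in
  [/\ 0 < N1, sigma^-1 * (p * th) <= W / N0 & W / N1 <= sigma * (p * th)].
Proof.
move=> p0 th0 E1 E2 e0 e1 S0.
rewrite ler_distl => /andP[h1 h2]; rewrite ler_distl => /andP[h3 h4].
rewrite ler_distl => /andP[h5 h6] /=.
have E0 : 0 < E by lra.
have SE0 : 0 < S * E by rewrite mulr_gt0.
have en : 0 < 1 - eta by lra.
have N1l : (1 - eta) * S <= N1 by rewrite mulrBl mul1r.
have N1p : 0 < N1 by rewrite (lt_le_trans _ N1l)// mulr_gt0.
have N0p : 0 < N0.
  by rewrite (@lt_le_trans _ _ ((1 - eta) * (S * E)))// ?mulr_gt0// mulrBl mul1r.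
have N0u : N0 <= (1 + eta) * (S * E) by rewrite mulrDl mul1r.
have Wl : (1 - eta) * (p * (S * E - S)) <= W by rewrite mulrBl mul1r.
have Wu : W <= (1 + eta) * (p * (S * E - S)) by rewrite mulrDl mul1r.
have sig0 : 0 < (1 + eta) / (1 - eta) * E by rewrite !mulr_gt0 ?invr_gt0//; lra.
split => //.
  rewrite ler_pdivlMr//; apply: le_trans Wl.
  apply: (@le_trans _ _ (((1 + eta) / (1 - eta) * E)^-1 * (p * th) * ((1 + eta) * (S * E)))).
    by rewrite ler_wpM2l// !mulr_ge0 ?invr_ge0// ltW.
  rewrite (_ : _ * ((1 + eta) * _) = (1 - eta) * p * S * th); last first.
    by field; apply/and3P; split; rewrite gt_eqF//; lra.
  rewrite (_ : (1 - eta) * (p * (S * E - S)) = (1 - eta) * p * S * (E - 1)); last by ring.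
  by rewrite ler_wpM2l // ?mulr_ge0 ?(ltW en, ltW p0, ltW S0)//; lra.
rewrite ler_pdivrMr//; apply: (le_trans Wu).
apply: (@le_trans _ _ ((1 + eta) / (1 - eta) * E * (p * th) * ((1 - eta) * S))); last first.
  by rewrite ler_wpM2l// mulr_ge0 ?(ltW sig0)// mulr_ge0 ?ltW.
rewrite (_ : _ * ((1 - eta) * S) = (1 + eta) * p * S * (E * th)); last first.
  by field; rewrite gt_eqF.
rewrite (_ : (1 + eta) * (p * (S * E - S)) = (1 + eta) * p * S * (E - 1)); last by ring.
by rewrite ler_wpM2l ?mulr_ge0 ?(ltW p0, ltW S0)//; lra.
Qed.

Section nelson_aalen_grid.
Context {R : realType}.
Variables (z : nat -> R) (b : nat -> bool) (k n : nat).
Hypothesis k0 : (0 < k)%N.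

Local Notation at_risk := (at_risk z n).
Local Notation na_sum := (na_sum z b n).

(** The analogue of [That] at an absolute level. Taken at nonrandom levels it is a sum of
    independent indicators, unlike [That], whose threshold is an order statistic. *)
Definition exceed (x : R) : R := k%:R^-1 * \sum_(i < n) (x < z i)%R%:R.

Definition window (x y : R) : R :=
  k%:R^-1 * \sum_(i < n) ((x < z i <= y) && b i)%:R.

(** Absolute endpoints make this additive over adjacent intervals; [na_sum v t] is the case of
    endpoints [v] and [v * t]. *)
Definition na_window (x y : R) : R :=
  \sum_(i < n) ((x < z i <= y) && b i)%:R / at_risk (z i).

Lemma na_windowD x y t : x <= y -> y <= t ->
  na_window x y + na_window y t = na_window x t.
Proof.
move=> xy yt; rewrite -big_split/=; apply: eq_bigr => i _.
rewrite -mulrDl; congr (_ / _); case: (b i); rewrite ?andbF ?addr0// !andbT.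
have [ziy|yzi] := leP (z i) y.
  by rewrite (le_trans ziy yt) !andbT addr0.
by rewrite (le_lt_trans xy)// andbF/= add0r.
Qed.

Lemma na_window_ge0 x y : 0 <= na_window x y.
Proof. by apply: sumr_ge0 => i _; rewrite divr_ge0// at_risk_ge0. Qed.

Let kR : (0 : R) < k%:R. Proof. by rewrite ltr0n. Qed.

(** A point of []x, y]] has at least as many observations at risk as there are exceedances of [y].
    Positivity of [exceed y] matters: otherwise the right side would be 0 by the convention for
    division. *)
Lemma na_window_le x y : 0 < exceed y -> na_window x y <= window x y / exceed y.
Proof.
move=> Ny; rewrite /window /exceed -mulf_div divff ?mul1r ?invr_eq0 ?gt_eqF//.
rewrite mulr_suml; apply: ler_sum => i _.
case/boolP: (_ && _) => [/andP[/andP[xz zy] _]|]; last by rewrite !mul0r.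
have S0 : 0 < \sum_(i < n) (y < z i)%R%:R :> R.
  by move: Ny; rewrite /exceed pmulr_rgt0// invr_gt0.
have le_risk : \sum_(i < n) (y < z i)%R%:R <= at_risk (z i).
  apply: ler_sum => j _; rewrite ler_nat.
  by case: ltP => // yzj; rewrite (le_trans zy)// ltW.
by rewrite !mul1r lef_pV2// posrE (lt_le_trans S0).
Qed.

Lemma na_window_ge x y : window x y / exceed x <= na_window x y.
Proof.
rewrite /window /exceed -mulf_div divff ?mul1r ?invr_eq0 ?gt_eqF//.
rewrite mulr_suml; apply: ler_sum => i _.
case/boolP: (_ && _) => [/andP[/andP[xz zy] _]|]; last by rewrite !mul0r.
have r0 : 0 < at_risk (z i).
  rewrite (lt_le_trans (ltr01))// /at_risk (bigD1 i)//= lexx lerDl.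
  by apply: sumr_ge0 => j _; exact: ler0n.
have ge_risk : at_risk (z i) <= \sum_(i < n) (x < z i)%R%:R.
  apply: ler_sum => j _; rewrite ler_nat.
  by have [zij|_] := leP (z i) (z j); rewrite ?leq0n// (lt_le_trans xz zij).
by rewrite !mul1r lef_pV2// posrE (lt_le_trans r0).
Qed.

Lemma grid_cell (f : nat -> R) m x : f 0%N <= x <= f m ->
  f 0%N = x \/ exists2 j, (j < m)%N & f j <= x <= f j.+1.
Proof.
elim: m => [/andP[h1 h2]|m IH /andP[h1 h2]].
  by left; apply/eqP; rewrite eq_le h1 h2.
have [xm|mx] := leP x (f m).
  have [|->|[j jm xj]] := IH; first by rewrite h1 xm.
    by left.
  by right; exists j => //; exact: ltnW.
by right; exists m => //; rewrite h2 ltW.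
Qed.

Variables (alpha p delta eta u : R).
Hypotheses (alpha0 : 0 < alpha) (p0 : 0 < p) (delta0 : 0 < delta)
  (eta0 : 0 < eta) (eta1 : eta < 1) (u0 : 0 < u).

(** Points are in units of the threshold [u]. The geometric grid starts at 1/2, the lower bound to
    be imposed on [v / u], and has ratio [expR delta], so that [ln] grows by [delta] on each
    cell. *)
Definition grid (j : nat) : R := expR (j%:R * delta) / 2.

Lemma grid_gt0 j : 0 < grid j.
Proof. by rewrite divr_gt0// expR_gt0. Qed.

Let s j := grid j `^ (- alpha).

Let s_gt0 j : 0 < s j. Proof. by rewrite powR_gt0// grid_gt0. Qed.

Let sS j : s j = s j.+1 * expR (alpha * delta).
Proof.
have gS : grid j.+1 = grid j * expR delta.
  by rewrite /grid -natr1 mulrDl mul1r expRD mulrAC.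
rewrite /s gS powRM ?expR_ge0 ?ltW ?grid_gt0//.
rewrite [X in _ * X * _]/powR gt_eqF ?expR_gt0// expRK -mulrA -expRD.
by rewrite mulNr addNr expR0 mulr1.
Qed.

Variable m : nat.
Hypothesis exceed_close : forall j, (j <= m)%N ->
  `|exceed (u * grid j) - s j| <= eta * s j.
Hypothesis window_close : forall j, (j < m)%N ->
  `|window (u * grid j) (u * grid j.+1) - p * (s j - s j.+1)| <=
    eta * (p * (s j - s j.+1)).

Let sigma := (1 + eta) / (1 - eta) * expR (alpha * delta).

Let sigma_ge1 : 1 <= sigma.
Proof.
rewrite /sigma -[leLHS]mulr1 ler_pM//.
  have := eta0; have := eta1.
  by rewrite ler_pdivlMr ?subr_gt0// mul1r; lra.
by rewrite -expR0 ler_expR mulr_ge0// ltW.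
Qed.

Let c := p * alpha.

(** The target [c * delta] is the exact increment of [c * ln] over one cell. *)
Lemma na_window_cell j : (j < m)%N ->
  sigma^-1 * (c * delta) <= na_window (u * grid j) (u * grid j.+1) <=
  sigma * (c * delta).
Proof.
move=> jm; have th0 : 0 < alpha * delta by rewrite mulr_gt0.
have := exceed_close (ltnW jm); have := window_close jm; rewrite (sS j) => hW hN.
(* This is [1 - th <= expR (- th)] multiplied by [expR th], with [th = alpha * delta]. *)
have Eth : expR (alpha * delta) - 1 <= expR (alpha * delta) * (alpha * delta).
  have := ler_wpM2l (ltW (expR_gt0 (alpha * delta))) (expR_ge1Dx (- (alpha * delta))).
  by rewrite -expRD subrr expR0 mulrBr mulr1 lerBlDr -lerBlDl.
have [N1 lo up] := cell_ratio_bounds p0 th0 (expR_ge1Dx _) Eth eta0 eta1 (s_gt0 _)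
  hN (exceed_close jm) hW.
rewrite /c -mulrA (le_trans lo (na_window_ge _ _))/=.
exact: le_trans (na_window_le _ N1) up.
Qed.

Lemma grid_mono i j : (i <= j)%N -> grid i <= grid j.
Proof.
by move=> ij; rewrite ler_pM2r// ler_expR ler_wpM2r ?ler_nat// ltW.
Qed.

Lemma na_window_grid j : (j <= m)%N ->
  sigma^-1 * (c * delta) * j%:R <= na_window (u * grid 0) (u * grid j) <=
  sigma * (c * delta) * j%:R.
Proof.
elim: j => [_|j IH jm].
  rewrite !mulr0 na_window_ge0/= /na_window big1// => i _.
  by have [uz|_] := ltP _ (z i); rewrite ?(lt_geF uz) mul0r.
rewrite -(@na_windowD _ (u * grid j)) ?ler_pM2l ?grid_mono//.
rewrite -natr1 !mulrDr !mulr1.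
have /andP[h1 h2] := IH (ltnW jm); have /andP[h3 h4] := na_window_cell jm.
by rewrite !lerD.
Qed.

Lemma ln_grid j : ln (grid j) = j%:R * delta - ln 2.
Proof. by rewrite ln_div ?posrE ?expR_gt0// expRK. Qed.

(** The increment of the limit over one cell, plus the relative error [sigma - 1] accumulated over
    [m] cells. *)
Let err := c * delta + (sigma - 1) * (c * delta) * m%:R.

Let c0 : 0 < c. Proof. by rewrite mulr_gt0. Qed.

(** Both functions of [x] are nondecreasing, so between two neighbouring grid points each is
    squeezed by its values there, which [na_window_grid] compares. *)
Lemma na_window_uniform x : grid 0 <= x <= grid m ->
  `|na_window (u * grid 0) (u * x) - c * (ln x + ln 2)| <= err.
Proof.
have cd0 : 0 < c * delta by rewrite mulr_gt0.
have s1 : 0 <= sigma - 1 by rewrite subr_ge0.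
(* Equivalent to [0 <= (sigma - 1) ^+ 2]; it makes the lower error linear in [sigma - 1], like the
   upper one. *)
have sV : 2 - sigma <= sigma^-1.
  rewrite -[leRHS]mul1r ler_pdivlMr ?(lt_le_trans ltr01)//.
  by have := sqr_ge0 (sigma - 1); rewrite expr2; nra.
move=> xm; have [<-|[j jm /andP[jx xj]]] := grid_cell xm.
  have := na_window_grid (leq0n m); rewrite !mulr0 => /le_anti <-.
  rewrite ln_grid subrK mul0r mulr0 subrr normr0.
  by rewrite addr_ge0 ?(ltW cd0)// mulr_ge0// mulr_ge0// ltW.
have x0 : 0 < x by rewrite (lt_le_trans (grid_gt0 j)).
have lx1 : j%:R * delta <= ln x + ln 2.
  by rewrite -lerBlDr -ln_grid ler_ln ?posrE ?grid_gt0.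
have lx2 : ln x + ln 2 <= j.+1%:R * delta.
  by rewrite -lerBrDr -ln_grid ler_ln ?posrE ?grid_gt0.
have /andP[n1 _] := na_window_grid (ltnW jm).
have /andP[_ n2] := na_window_grid jm.
have ux : u * grid j <= u * x by rewrite ler_pM2l.
have xu : u * x <= u * grid j.+1 by rewrite ler_pM2l.
have u0j : u * grid 0 <= u * grid j by rewrite ler_pM2l// grid_mono.
have D1 := na_windowD u0j ux; have D2 := na_windowD (le_trans u0j ux) xu.
have p1 := na_window_ge0 (u * grid j) (u * x).
have p2 := na_window_ge0 (u * x) (u * grid j.+1).
have jmR : j.+1%:R <= m%:R :> R by rewrite ler_nat.
have c1 := ler_wpM2l (ltW c0) lx1; have c2 := ler_wpM2l (ltW c0) lx2.
have m1 : (sigma - 1) * (c * delta) * j.+1%:R <= (sigma - 1) * (c * delta) * m%:R.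
  by rewrite ler_wpM2l// mulr_ge0// ltW.
have m2 : (2 - sigma) * (c * delta) * j%:R <= sigma^-1 * (c * delta) * j%:R.
  by rewrite !ler_wpM2r// ltW.
have m3 : 0 <= (sigma - 1) * (c * delta) by rewrite mulr_ge0// ltW.
rewrite -natr1 in m1 n2 c2; rewrite mulrDl mulrDr in c2.
have e1 : (sigma - 1) * (c * delta) * (j%:R + 1) =
  sigma * (c * delta) * (j%:R + 1) - c * (j%:R * delta) - c * (1 * delta) by ring.
have e2 : (2 - sigma) * (c * delta) * j%:R =
  c * (j%:R * delta) - (sigma - 1) * (c * delta) * (j%:R + 1) + (sigma - 1) * (c * delta) by ring.
rewrite ler_norml /err; apply/andP; split; lra.
Qed.

(** The sum is a difference of two values of [na_window] from [grid 0], whence the factor 2, and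
    [ln 2] cancels. The choice of [m * delta] puts the last grid point at [2 * A], which bounds
    [v * t / u]. *)
Lemma na_sum_close v A t : m%:R * delta = ln (4 * A) -> u / 2 <= v <= 2 * u ->
  1 <= t <= A -> `|na_sum v t - c * ln t| <= 2 * err.
Proof.
move=> md /andP[uv vu] /andP[t1 tA].
have v0 : 0 < v by rewrite (lt_le_trans _ uv)// divr_gt0.
have t0 : 0 < t by rewrite (lt_le_trans ltr01).
have A0 : 0 < A by rewrite (lt_le_trans t0).
have vu0 : 0 < v / u by rewrite divr_gt0.
have uK y : u * (y / u) = y by rewrite mulrC divfK// gt_eqF.
have g0 : grid 0 = 2^-1 by rewrite /grid mul0r expR0 div1r.
have gm : grid m = 2 * A.
  rewrite /grid md lnK ?posrE ?mulr_gt0//.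
  by rewrite (_ : 4 = 2 * 2 :> R) ?(mulrAC _ _ A) ?mulfK//; ring.
have r1 : grid 0 <= v / u <= grid m.
  rewrite g0 gm ler_pdivlMr// ler_pdivrMr// mulrC uv/= (le_trans vu)//.
  by rewrite ler_pM2r// ler_peMr// (le_trans t1).
have r2 : grid 0 <= v * t / u <= grid m.
  rewrite g0 gm ler_pdivlMr// ler_pdivrMr// mulrC; apply/andP; split.
    by rewrite (le_trans uv)// ler_peMr// ltW.
  by rewrite [leRHS]mulrAC ler_pM// ltW.
have := na_window_uniform r2; have := na_window_uniform r1.
rewrite !uK [v * t / u]mulrAC (@lnM _ (v / u) t) ?posrE//.
have vt : v <= v * t by rewrite ler_peMr// ltW.
have gv : u * grid 0 <= v by rewrite g0.
rewrite -(na_windowD gv vt) (_ : na_window v (v * t) = na_sum v t)//.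
by rewrite !ler_norml => /andP[h1 h2] /andP[h3 h4]; apply/andP; split; lra.
Qed.

End nelson_aalen_grid.

(** * Measurability *)

(** Order statistics are numbered from 1 and [nth] from 0, hence [j.-1]; the bound on it excludes
    the default value of [nth]. *)
Lemma order_stat_le (R : realType) (z : nat -> R) j n x : (j.-1 < n)%N ->
  (order_stat z j n <= x) = (j.-1%:R < \sum_(i < n) (z i <= x)%R%:R :> R).
Proof.
move=> jn; rewrite /order_stat; set s := sort _ _.
have ss : sorted <=%R s by apply: sort_sorted; exact: le_total.
have sz : size s = n by rewrite size_sort size_mkseq.
have cE : count (<= x)%R s = (\sum_(i < n) (z i <= x)%R)%N.
  rewrite count_sort count_map -sum1_count big_mkcond.
  rewrite -(big_mkord xpredT (fun i => nat_of_bool (z i <= x))) /index_iota subn0.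
  by apply: eq_bigr => i _ /=; case: ifP.
rewrite -natr_sum ltr_nat -cE; apply/idP/idP; last exact: nth_count_le.
move=> xs; rewrite ltnNge; apply/negP => cj.
have := @nth_count_gt _ _ x 0 s j.-1 ss; rewrite cj sz => /(_ jn).
by rewrite ltNge xs.
Qed.

Lemma lt_sup_distP (R : realType) (f g : R -> R) (a b eps : R) : a <= b ->
  (eps%:E < `|sup_dist a b f g|)%E <-> exists2 t, a <= t <= b & eps < `|f t - g t|.
Proof.
move=> ab; rewrite gee0_abs; last first.
  apply: (@le_trans _ _ (`|f a - g a|%:E)) => //.
  by apply: ereal_sup_ubound; exists a => //=; rewrite in_itv/= lexx.
split.
  move=> /ereal_sup_gt[_ [t tab <-]]; rewrite lte_fin => et.
  by exists t => //; move: tab; rewrite /= in_itv.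
move=> [t tab et]; apply: (@lt_le_trans _ _ (`|f t - g t|%:E)).
  by rewrite lte_fin.
by apply: ereal_sup_ubound; exists t => //=; rewrite in_itv.
Qed.

Section measurability.
Context {d : measure_display} {T : measurableType d} {R : realType}.

Lemma measurable_bool_set (c : T -> bool) :
  measurable_fun setT c -> measurable [set w | c w].
Proof. by move=> mc; have := mc measurableT [set true] I; rewrite setTI. Qed.

Lemma measurable_bool_natr (c : T -> bool) :
  measurable_fun setT c -> measurable_fun setT (fun w => (c w)%:R : R).
Proof.
move=> mc; rewrite (_ : (fun w => _) = (fun w => if c w then 1 else 0)).
  exact: measurable_fun_ifT.
by apply/funext => w; case: (c w).
Qed.

Lemma measurable_invr_ge0 (f : T -> R) : (forall w, 0 <= f w) ->
  measurable_fun setT f -> measurable_fun setT (fun w => (f w)^-1).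
Proof.
move=> f0 mf; rewrite (_ : (fun w => _) = (@powR R ^~ (-1)) \o f).
  exact: (measurableT_comp (measurable_powR _)).
by apply/funext => w /=; rewrite powR_inv1.
Qed.

(** A deviation above [eps] at some [t < b] persists just to the right of [t], hence at a rational
    time. The event is thus a countable union, with [b] added separately since it has no right
    neighbour in the interval. *)
Lemma measurable_eps_lt_sup_dist (f : T -> R -> R) (g : R -> R) (a b eps : R) :
  a <= b ->
  (forall t, measurable_fun setT (f^~ t)) ->
  (forall w t, a <= t < b -> \forall x \near t^'+, f w x = f w t) ->
  (forall t, a <= t < b -> g x @[x --> t^'+] --> g t) ->
  measurable [set w | (eps%:E < `|sup_dist a b (f w) g|)%E].
Proof.
move=> ab mf fr gr.
pose E t := [set w | eps < `|f w t - g t|].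
have mE t : measurable (E t).
  apply: measurable_bool_set; apply: measurable_fun_ltr => //.
  by apply: measurableT_comp => //; exact: measurable_funB.
suff -> : [set w | (eps%:E < `|sup_dist a b (f w) g|)%E] =
    E b `|` \bigcup_(q in [set: rat]) (if a <= ratr q <= b then E (ratr q) else set0).
  apply: measurableU => //; apply: bigcupT_measurable_rat => q.
  by case: ifP.
apply/seteqP; split => w /=.
  move=> /(lt_sup_distP _ _ _ ab)[t /andP[at_ tb] et].
  have [tb_eq|tNb] := eqVneq t b; first by left; rewrite /E/= -tb_eq.
  right.
  have tltb : t < b by rewrite lt_neqAle tNb.
  have atb : a <= t < b by rewrite at_.
  have : \forall x \near t^'+, [/\ t < x, x < b & eps < `|f w x - g x|].
    have h1 := fr w _ atb.
    have h2 : \forall x \near t^'+, eps < `|f w t - g x|.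
      have : `|f w t - g x| @[x --> t^'+] --> `|f w t - g t|.
        by apply: cvg_norm; apply: cvgB; [exact: cvg_cst|exact: gr].
      by move=> /cvgr_gt; apply.
    near=> x; split.
    - by near: x; exact: nbhs_right_gt.
    - by near: x; exact: nbhs_right_lt.
    - by rewrite (near h1 x) ?(near h2 x).
  case=> e /= e0 He.
  have [|q] := @rat_in_itvoo R t (t + e); first by rewrite ltrDl.
  rewrite in_itv/= => /andP[tq qe]; exists q => //.
  have [||_ qb eq] := He (ratr q) => //.
    by rewrite /ball/= distrC ger0_norm ?ltrBlDl// subr_ge0 ltW.
  by rewrite (le_trans at_ (ltW tq)) (ltW qb).
case=> [eb|[q _]].
  by apply/lt_sup_distP => //; exists b; rewrite ?ab ?lexx.
by case: ifP => // aqb eq; apply/lt_sup_distP => //; exists (ratr q).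
Unshelve. all: by end_near. Qed.

Variables (Z : nat -> T -> R) (D : nat -> T -> bool).
Hypotheses (mZ : forall i, measurable_fun setT (Z i))
  (mD : forall i, measurable_fun setT (D i)).

Lemma measurable_order_stat j n : measurable_fun setT (fun w => order_stat (Z^~ w) j n).
Proof.
(* Out of range, [nth] returns the constant 0. *)
have [nj|jn] := leqP n j.-1.
  rewrite (_ : (fun w => _) = cst 0) //; apply/funext => w.
  by rewrite /order_stat nth_default// size_sort size_mkseq.
move=> mT; apply: (measurability _ (RGenOInfty.measurableE R)) => // _ [_ [x ->] <-].
rewrite setTI.
rewrite (_ : _ @^-1` _ = [set w | \sum_(i < n) (Z i w <= x)%R%:R <= j.-1%:R :> R]).
  apply: measurable_bool_set; apply: measurable_fun_ler => //.
  apply: measurable_sum => i; apply: measurable_bool_natr.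
  exact: measurable_fun_ler.
apply/seteqP; split => w /=; rewrite in_itv/= andbT; by rewrite ltNge order_stat_le// -leNgt.
Qed.

Lemma measurable_at_risk n (f : T -> R) : measurable_fun setT f ->
  measurable_fun setT (fun w => at_risk (Z^~ w) n (f w)).
Proof.
move=> mf; apply: measurable_sum => i; apply: measurable_bool_natr.
exact: measurable_fun_ler.
Qed.

Lemma measurable_jump_at n i :
  measurable_fun setT (fun w => jump_at (Z^~ w) (D^~ w) n (Z i w)).
Proof.
apply: measurable_sum => j; apply: measurable_funM.
  apply: measurable_bool_natr; apply: measurable_and => //.
  exact: measurable_fun_eqr.
apply: measurable_invr_ge0; first by move=> w; exact: at_risk_ge0.
exact: measurable_at_risk.
Qed.

Variables (k n : nat).
Hypothesis k0 : (0 < k)%N.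

Let v w := order_stat (Z^~ w) (n - k) n.

Let mv : measurable_fun setT v. Proof. exact: measurable_order_stat. Qed.

Let min_range i t : measurable_fun setT (fun w => v w < Z i w <= v w * t).
Proof.
apply: measurable_and; first exact: measurable_fun_ltr.
by apply: measurable_fun_ler => //; exact: measurable_funM.
Qed.

Lemma measurable_nelson_aalen t :
  measurable_fun setT (fun w => nelson_aalen (Z^~ w) (D^~ w) k n t).
Proof.
rewrite (_ : (fun w => _) =
    (fun w => if 0 < v w then na_sum (Z^~ w) (D^~ w) n (v w) t else 0)); last first.
  apply/funext => w; case: ltP => v0; first by rewrite nelson_aalenE.
  by rewrite nelson_aalen_le0.
apply: measurable_fun_ifT => //; first exact: measurable_fun_ltr.
apply: measurable_sum => i; apply: measurable_funM.
  by apply: measurable_bool_natr; exact: measurable_and.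
apply: measurable_invr_ge0; first by move=> w; exact: at_risk_ge0.
exact: measurable_at_risk.
Qed.

Lemma measurable_kaplan_meier t :
  measurable_fun setT (fun w => kaplan_meier (Z^~ w) (D^~ w) k n t).
Proof.
rewrite (_ : (fun w => _) =
    (fun w => if 0 < v w then 1 - km_prod (Z^~ w) (D^~ w) n (v w) t else 0)); last first.
  apply/funext => w; case: ltP => v0; first by rewrite kaplan_meierE.
  by rewrite kaplan_meier_le0.
apply: measurable_fun_ifT => //; first exact: measurable_fun_ltr.
apply: measurable_funB => //.
(* The index set depends on [w]; moving the condition into the factors gives a product over a fixed
   set. *)
rewrite (_ : (fun w => _) = (fun w => \prod_(i < n)
    if first_index (Z^~ w) i && (v w < Z i w <= v w * t)
    then 1 - jump_at (Z^~ w) (D^~ w) n (Z i w) else 1)); last first.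
  by apply/funext => w; rewrite /km_prod big_mkcond.
apply: measurable_prod => i _; apply: measurable_fun_ifT => //.
  apply: measurable_and => //.
  apply: (measurable_fun_bool true).
  rewrite setTI (_ : _ @^-1` _ =
    \bigcap_(j in setT) [set w | (j < i)%N ==> (Z j w != Z i w)]).
    apply: bigcapT_measurable => j; apply: measurable_bool_set.
    case: (j < i)%N => //=; apply: measurable_neg; exact: measurable_fun_eqr.
  apply/seteqP; split => w /=.
    move=> /forallP fw j _; apply/implyP => ji.
    by have := fw (Ordinal (ltn_trans ji (ltn_ord i))); rewrite /= ji.
  by move=> fw; apply/forallP => j; exact: fw.
by apply: measurable_funB => //; exact: measurable_jump_at.
Qed.

Let range_near w t : 0 < v w ->
  \forall x \near t^'+, forall i : 'I_n, (Z i w <= v w * x) = (Z i w <= v w * t).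
Proof.
move=> v0; apply: filter_forall => i; case: (leP (Z i w) (v w * t)) => [zvt|vtz].
  by near=> x; rewrite (le_trans zvt)// ler_pM2l// ltW.
near=> x; apply/negbTE; rewrite -ltNge mulrC -ltr_pdivlMr//.
by near: x; apply: nbhs_right_lt; rewrite ltr_pdivlMr// mulrC.
Unshelve. all: by end_near. Qed.

Lemma nelson_aalen_near w t : \forall x \near t^'+,
  nelson_aalen (Z^~ w) (D^~ w) k n x = nelson_aalen (Z^~ w) (D^~ w) k n t.
Proof.
have [v0|v0] := ltP 0 (v w); last by near=> x; rewrite !nelson_aalen_le0.
apply: filterS (range_near t v0) => x hx; rewrite !nelson_aalenE//.
by apply: eq_bigr => i _; rewrite hx.
Unshelve. all: by end_near. Qed.

Lemma kaplan_meier_near w t : \forall x \near t^'+,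
  kaplan_meier (Z^~ w) (D^~ w) k n x = kaplan_meier (Z^~ w) (D^~ w) k n t.
Proof.
have [v0|v0] := ltP 0 (v w); last by near=> x; rewrite !kaplan_meier_le0.
apply: filterS (range_near t v0) => x hx; rewrite !kaplan_meierE//.
by congr (1 - _); apply: eq_bigl => i; rewrite hx.
Unshelve. all: by end_near. Qed.

End measurability.

(** * Weak law for exceedance counts *)

Section vanishing_events.
Context {d : measure_display} {T : measurableType d} {R : realType}.
Variable P : probability T R.

(** Measurability is part of the notion because monotonicity and subadditivity of [P] require it. *)
Definition vanishing (E : nat -> set T) : Prop :=
  (forall n, measurable (E n)) /\ P (E n) @[n --> \oo] --> (0 : \bar R).

Lemma vanishing_setU E F : vanishing E -> vanishing F ->
  vanishing (fun n => E n `|` F n).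
Proof.
move=> [mE E0] [mF F0]; split; first by move=> n; exact: measurableU.
apply: (@squeeze_cvge _ _ _ _ (cst 0%E) _ (fun n => (P (E n) + P (F n))%E)).
- by near=> n; rewrite measure_ge0/= measureU2.
- exact: cvg_cst.
- by rewrite -[X in _ --> X](adde0 0%E); exact: cvgeD.
Unshelve. all: by end_near. Qed.

Lemma vanishing_bigsetU m (E : nat -> nat -> set T) :
  (forall j, (j < m)%N -> vanishing (E j)) ->
  vanishing (fun n => \big[setU/set0]_(j < m) E j n).
Proof.
elim: m => [_|m IH vE].
  split; first by move=> n; rewrite big_ord0.
  rewrite (_ : (fun n => _) = cst 0%E); first exact: cvg_cst.
  by apply/funext => n; rewrite big_ord0 measure0.
rewrite (_ : (fun n => _) = (fun n => \big[setU/set0]_(j < m) E j n `|` E m n)).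
  apply: vanishing_setU; last exact: vE.
  by apply: IH => j jm; apply: vE; exact: ltnW.
by apply/funext => n; rewrite big_ord_recr.
Qed.

Lemma vanishing_sub (E F : nat -> set T) : vanishing F ->
  (\forall n \near \oo, measurable (E n) /\ E n `<=` F n) ->
  P (E n) @[n --> \oo] --> (0 : \bar R).
Proof.
move=> [mF F0] EF.
apply: (@squeeze_cvge _ _ _ _ (cst 0%E) _ (P \o F)) => //; last exact: cvg_cst.
near=> n; have [mE sEF] : measurable (E n) /\ E n `<=` F n by near: n; exact: EF.
by rewrite measure_ge0/= le_measure ?inE.
Unshelve. all: by end_near. Qed.

(** A triangular array: the events may change with [n]. Once the bias is below [eps / 2], Chebyshev
    at level [k n * (eps / 2)] bounds the probability by a convergent factor divided by [k n]. *)
Lemma weak_law (c : nat -> nat -> T -> bool) (q : nat -> R) (k : nat -> nat) (l eps : R) :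
  (forall n i, measurable_fun setT (c n i)) ->
  (forall n i, P [set w | c n i w] = (q n)%:E) ->
  (forall n i j, i != j -> P ([set w | c n i w] `&` [set w | c n j w]) =
                     (P [set w | c n i w] * P [set w | c n j w])%E) ->
  k n @[n --> \oo] --> \oo ->
  n%:R * q n / (k n)%:R @[n --> \oo] --> l ->
  0 < eps ->
  vanishing (fun n => [set w | eps < `|(k n)%:R^-1 * \sum_(i < n) (c n i w)%:R - l|]).
Proof.
move=> mc cq cind k_oo nq e0; pose E n i := [set w | c n i w].
have mE n i : measurable (E n i) by exact: measurable_bool_set.
have indE n i w : \1_(E n i) w = (c n i w)%:R :> R.
  by rewrite indicE; congr ((nat_of_bool _)%:R); apply/idP/idP; rewrite inE.
have mG n : measurable [set w | eps < `|(k n)%:R^-1 * \sum_(i < n) (c n i w)%:R - l|].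
  apply: measurable_bool_set; apply: measurable_fun_ltr => //.
  apply: measurableT_comp => //; apply: measurable_funB => //.
  apply: measurable_funM => //; apply: measurable_sum => i.
  exact: measurable_bool_natr.
split=> //.
have kpos : \forall n \near \oo, (0 < k n)%N by move/cvgnyPgt : k_oo; exact.
pose r n := n%:R * q n / (k n)%:R.
apply: (@squeeze_cvge _ _ _ _ (cst 0%E) _
  (fun n => (r n * (2 / eps) ^+ 2 * (k n)%:R^-1)%:E)); last 2 first.
- exact: cvg_cst.
- apply: cvg_EFin; first by near=> n.
  rewrite -(mulr0 (l * (2 / eps) ^+ 2)).
  apply: cvgM; first by apply: cvgM => //; exact: cvg_cst.
  apply/gtr0_cvgV0; last exact/cvgrnyP.
  by near=> n; rewrite ltr0n; near: n; exact: kpos.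
near=> n.
have kn0 : 0 < (k n)%:R :> R.
  by rewrite ltr0n; near: n; exact: kpos.
have rl : `|l - r n| < eps / 2.
  by near: n; move/cvgrPdist_lt : nq; apply; rewrite divr_gt0.
rewrite measure_ge0/=.
have ke : 0 < (k n)%:R * (eps / 2) by rewrite mulr_gt0// divr_gt0.
have := counting_chebyshev n (mE n) (cq n) (cind n) ke.
rewrite (_ : n%:R * q n / _ = r n * (2 / eps) ^+ 2 * (k n)%:R^-1); last first.
  by rewrite /r; field; rewrite !gt_eqF.
apply: le_trans; apply: le_measure; rewrite ?inE//.
  apply: measurable_bool_set; apply: measurable_fun_ler => //.
  apply: measurableT_comp => //; apply: measurable_funB => //.
  by apply: measurable_sum => i; exact: measurable_indic.
move=> w /=; under [X in _ -> _ <= `|X - _|]eq_bigr do rewrite indE.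
set S := \sum_(i < n) _ => h.
have -> : S - n%:R * q n = (k n)%:R * ((k n)%:R^-1 * S - l + (l - r n)).
  by rewrite /r; field; rewrite gt_eqF.
rewrite normrM gtr0_norm// ler_pM2l//.
have := lerB_normD ((k n)%:R^-1 * S - l) (l - r n).
lra.
Unshelve. all: by end_near. Qed.

End vanishing_events.

(** * Regularly varying tails *)

(** Slow variation at ratio 1 makes [L t / L t] tend to 1; this quotient is 0 wherever [L t = 0], so
    [L] is eventually nonzero. The tail is then positive far out, and everywhere by monotonicity. *)
Lemma regular_tail_gt0 (R : realType) (F L : R -> R) (g : R) :
  slowly_varying L -> (forall x, 0 < x -> 1 - F x = L x * x `^ (- g)) ->
  {homo F : x y / x <= y} -> (forall x, F x <= 1) -> forall x, 0 < 1 - F x.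
Proof.
move=> sL FL ndF F1 x.
have : \forall t \near +oo, L (t * 1) / L t != 0.
  have := sL 1 ltr01; move=> /cvgr_neq0; apply; exact: oner_neq0.
move=> Lneq.
have [t [xt t0 Lt]] : exists t, [/\ x <= t, 0 < t & L t != 0].
  have : \forall t \near +oo, [/\ x <= t, 0 < t & L t != 0].
    near=> t; split.
    - by near: t; exact: (nbhs_pinfty_ge (num_real _)).
    - by near: t; exact: (nbhs_pinfty_gt (num_real _)).
    - have : L (t * 1) / L t != 0 by near: t; exact: Lneq.
      by rewrite mulr1; apply: contra_neq => ->; rewrite mul0r.
  by move=> /filter_ex.
have Ft : 0 < 1 - F t.
  rewrite lt_neqAle subr_ge0 F1 andbT eq_sym FL// mulf_neq0//.
  by rewrite gt_eqF// powR_gt0.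
by rewrite (lt_le_trans Ft)// lerB// ndF.
Unshelve. all: by end_near. Qed.

Lemma regular_tail_ratio (R : realType) (F L : R -> R) (g : R) (u : nat -> R) x :
  slowly_varying L -> (forall x, 0 < x -> 1 - F x = L x * x `^ (- g)) ->
  u n @[n --> \oo] --> +oo -> 0 < x ->
  (1 - F (u n * x)) / (1 - F (u n)) @[n --> \oo] --> x `^ (- g).
Proof.
move=> sL FL u_oo x0.
have Lr : L (u n * x) / L (u n) @[n --> \oo] --> (1 : R).
  exact: (cvg_comp _ _ u_oo (sL x x0)).
rewrite -[X in _ --> X]mul1r.
apply: cvg_trans (cvgM Lr (cvg_cst (x `^ (- g)))).
apply: near_eq_cvg; near=> n.
have u0 : 0 < u n by near: n; exact: (u_oo _ (nbhs_pinfty_gt (num_real 0))).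
rewrite /= !FL ?mulr_gt0// powRM ?ltW//.
have : u n `^ (- g) != 0 by rewrite gt_eqF// powR_gt0.
move: (_ `^ _) => y y0.
rewrite invfM.
rewrite [X in _ = X](_ : _ = L (u n * x) * (L (u n))^-1 * (y * y^-1) * x `^ (- g)); last by ring.
by rewrite divff// mulr1.
Unshelve. all: by end_near. Qed.

(** * Limits of exceedance and window probabilities *)

Section tail_limits.
Context {d : measure_display} {T : measurableType d} {R : realType}.
Variable P : probability T R.
Variables (X Y : nat -> {RV P >-> R}) (FX FY LX LY : R -> R) (gammaX gammaY : R).
Hypothesis hindep : mutually_independent
    (fun i : nat + nat => match i with inl j => X j | inr j => Y j end).
Hypotheses (hX : forall i x, cdf (X i) x = (FX x)%:E)
  (hY : forall i x, cdf (Y i) x = (FY x)%:E)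
  (hgX : 0 < gammaX) (hgY : 0 < gammaY)
  (hLX : slowly_varying LX) (hLY : slowly_varying LY)
  (hFX : forall x : R, 0 < x -> 1 - FX x = LX x * x `^ (- gammaX^-1))
  (hFY : forall x : R, 0 < x -> 1 - FY x = LY x * x `^ (- gammaY^-1)).
Variables (Z : nat -> T -> R) (delta : nat -> T -> bool).
Hypotheses (hZ : forall i w, Z i w = Num.min (X i w) (Y i w))
  (hdelta : forall i w, delta i w = (X i w <= Y i w)).

Let eqX i x : cdf (X i) x = cdf (X 0%N) x. Proof. by rewrite !hX. Qed.
Let eqY i x : cdf (Y i) x = cdf (Y 0%N) x. Proof. by rewrite !hY. Qed.

Lemma measurable_Z i : measurable_fun setT (Z i).
Proof.
by rewrite (_ : Z i = (fun w => Num.min (X i w) (Y i w)));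
  [exact: measurable_minr|apply/funext => w].
Qed.

Lemma measurable_delta i : measurable_fun setT (delta i).
Proof.
by rewrite (_ : delta i = (fun w => X i w <= Y i w));
  [exact: measurable_fun_ler|apply/funext => w].
Qed.

Let W i w := (X i w, Y i w).

Let exceedE x i : [set w | x < Z i w] = W i @^-1` (`]x, +oo[ `*` `]x, +oo[).
Proof.
by apply/seteqP; split => w /=; rewrite !in_itv/= !andbT hZ lt_min => /andP.
Qed.

Let mexceed x : measurable ((`]x, +oo[ `*` `]x, +oo[)%classic : set (R * R)).
Proof. exact: measurableX. Qed.

(** Because of the constraint [r.1 <= r.2] this is not a rectangle, which is why laws and
    independence were extended to all measurable sets of the plane. *)
Let windowS x y : set (R * R) := [set r | (x < Num.min r.1 r.2 <= y) && (r.1 <= r.2)].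

Let windowE x y i : [set w | (x < Z i w <= y) && delta i w] = W i @^-1` windowS x y.
Proof. by apply/seteqP; split => w /=; rewrite hZ hdelta. Qed.

Let mwindow x y : measurable (windowS x y).
Proof.
apply: measurable_bool_set; apply: measurable_and; last exact: measurable_fun_ler.
apply: measurable_and; first by apply: measurable_fun_ltr => //; exact: measurable_minr.
by apply: measurable_fun_ler => //; exact: measurable_minr.
Qed.

Lemma exceed_ident x i : P [set w | x < Z i w] = P [set w | x < Z 0%N w].
Proof. by rewrite !exceedE; exact: (pair_ident hindep eqX eqY i (mexceed x)). Qed.

Lemma exceed_indep x i j : i != j ->
  P ([set w | x < Z i w] `&` [set w | x < Z j w]) =
  (P [set w | (x < Z i w)%R] * P [set w | (x < Z j w)%R])%E.
Proof. by move=> ij; rewrite !exceedE; exact: (pair_indep hindep ij (mexceed x) (mexceed x)). Qed.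

Lemma window_ident x y i : P [set w | (x < Z i w <= y) && delta i w] =
  P [set w | (x < Z 0%N w <= y) && delta 0%N w].
Proof. by rewrite !windowE; exact: (pair_ident hindep eqX eqY i (mwindow x y)). Qed.

Lemma window_indep x y i j : i != j ->
  P ([set w | (x < Z i w <= y) && delta i w] `&`
     [set w | (x < Z j w <= y) && delta j w]) =
  (P [set w | (x < Z i w <= y)%R && delta i w] *
   P [set w | (x < Z j w <= y)%R && delta j w])%E.
Proof. by move=> ij; rewrite !windowE; exact: (pair_indep hindep ij (mwindow x y) (mwindow x y)). Qed.

Let FZ := dist_fun P (Z 0%N).

Lemma tailE (V : {RV P >-> R}) F x : (forall x, cdf V x = (F x)%:E) ->
  P (V @^-1` `]x, +oo[) = (1 - F x)%:E.
Proof.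
move=> VF; rewrite -setCitvl preimage_setC probability_setC; last exact: (RV_preimage V (measurable_itv _)).
by rewrite EFinB -VF.
Qed.

Lemma exceed_prob x : P [set w | x < Z 0%N w] = (1 - FZ x)%:E.
Proof.
have mZ0 : measurable [set w | Z 0%N w <= x].
  by apply: measurable_bool_set; apply: measurable_fun_ler => //; exact: measurable_Z.
rewrite (_ : [set w | x < Z 0%N w] = ~` [set w | Z 0%N w <= x]); last first.
  by apply/seteqP; split => w /=; rewrite ltNge => /negP.
by rewrite probability_setC// EFinB /FZ /dist_fun fineK// fin_num_measure.
Qed.

Lemma tail_FZ x : 1 - FZ x = (1 - FX x) * (1 - FY x).
Proof.
apply: EFin_inj; rewrite -exceed_prob exceedE (pair_rect hindep)//.
by rewrite (tailE _ (hX 0)) (tailE _ (hY 0)).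
Qed.

Let cdf_homo (V : {RV P >-> R}) F : (forall x, cdf V x = (F x)%:E) ->
  {homo F : x y / x <= y} /\ (forall x, F x <= 1).
Proof.
move=> VF; split=> [x y xy|x]; rewrite -lee_fin -!VF; first exact: cdf_nondecreasing.
exact: cdf_le1.
Qed.

Lemma tail_FX_gt0 x : 0 < 1 - FX x.
Proof. by have [h1 h2] := cdf_homo (hX 0); exact: (regular_tail_gt0 hLX hFX). Qed.

Lemma tail_FY_gt0 x : 0 < 1 - FY x.
Proof. by have [h1 h2] := cdf_homo (hY 0); exact: (regular_tail_gt0 hLY hFY). Qed.

Lemma tail_FZ_gt0 x : 0 < 1 - FZ x.
Proof. by rewrite tail_FZ mulr_gt0// ?tail_FX_gt0 ?tail_FY_gt0. Qed.

Variables (k : nat -> nat) (u : nat -> R) (gamma p : R).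
Hypotheses (hgamma : gamma = gammaX * gammaY / (gammaX + gammaY))
  (hk : k n @[n --> \oo] --> \oo)
  (hkn : ((k n)%:R / n%:R) @[n --> \oo] --> (0 : R))
  (huk : \forall n \near \oo, n%:R * (1 - FZ (u n)) = (k n)%:R :> R).

Lemma gammaVE : gamma^-1 = gammaX^-1 + gammaY^-1.
Proof. by rewrite hgamma; field; rewrite !gt_eqF ?addr_gt0. Qed.

(** The tail of [Z] at [u n] is [k n / n], which falls below its positive value at any fixed [M]; by
    monotonicity [u n] cannot stay below [M]. *)
Lemma threshold_pinfty : u n @[n --> \oo] --> +oo.
Proof.
apply/cvgryPge => M.
have h : \forall n \near \oo, (k n)%:R / n%:R < 1 - FZ M.
  by move/cvgr_lt : hkn; apply; exact: tail_FZ_gt0.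
near=> n; rewrite leNgt; apply/negP => uM.
have n0 : 0 < n%:R :> R by rewrite ltr0n; near: n; exact: nbhs_infty_gt.
have : (k n)%:R / n%:R < 1 - FZ M by near: n; exact: h.
rewrite (_ : (k n)%:R = n%:R * (1 - FZ (u n))); last by apply/esym; near: n; exact: huk.
rewrite mulrAC divff ?gt_eqF// mul1r; apply/negP; rewrite -leNgt.
have [hX1 _] := cdf_homo (hX 0); have [hY1 _] := cdf_homo (hY 0).
rewrite !tail_FZ ler_pM ?(ltW (tail_FX_gt0 _)) ?(ltW (tail_FY_gt0 _))//.
  by rewrite lerB// hX1// ltW.
by rewrite lerB// hY1// ltW.
Unshelve. all: by end_near. Qed.

(** The tail of the minimum is the product of the two tails, so the exponents add up to
    [gamma^-1]. *)
Lemma exceed_rate x : 0 < x ->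
  n%:R * (1 - FZ (u n * x)) / (k n)%:R @[n --> \oo] --> x `^ (- gamma^-1).
Proof.
move=> x0; rewrite gammaVE opprD powRD; last by rewrite (gt_eqF x0) implybT.
have cX := regular_tail_ratio hLX hFX threshold_pinfty x0.
have cY := regular_tail_ratio hLY hFY threshold_pinfty x0.
apply: cvg_trans (cvgM cX cY); apply: near_eq_cvg; near=> n.
have n0 : 0 < n%:R :> R by rewrite ltr0n; near: n; exact: nbhs_infty_gt.
rewrite /= (_ : (k n)%:R = n%:R * (1 - FZ (u n))); last by apply/esym; near: n; exact: huk.
rewrite !tail_FZ; field.
by rewrite !gt_eqF ?tail_FX_gt0 ?tail_FY_gt0.
Unshelve. all: by end_near. Qed.

Hypothesis hcond2 : forall a b : R, 0 < a -> a < b ->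
    limn_esup (fun n : nat => ((Num.sqrt (k n)%:R)%:E *
      ereal_sup [set (`| fine (P [set w | [/\ (u n * st.1 < Z 0%N w)%R,
                                              (Z 0%N w <= u n * st.2)%R
                                            & delta 0%N w]]) / (1 - FZ (u n))
                        - p * (st.1 `^ (- gamma^-1)
                               - st.2 `^ (- gamma^-1)) |%R)%:E
                | st in [set st : R * R |
                          [/\ (a <= st.1)%R, (st.1 <= st.2)%R
                            & (st.2 < b)%R]]])%E)
    = 0%E.

Let window_prob x y : R := fine (P [set w | (x < Z 0%N w <= y) && delta 0%N w]).

Lemma window_rate s t : 0 < s -> s <= t ->
  n%:R * window_prob (u n * s) (u n * t) / (k n)%:R @[n --> \oo] -->
    p * (s `^ (- gamma^-1) - t `^ (- gamma^-1)).
Proof.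
(* The range of Condition 1 is open at its right end, so [t + 1] is taken there to include [t]. *)
move=> s0 st; have st1 : s < t + 1 by rewrite ltr_pwDr.
set l := p * _.
pose x n := window_prob (u n * s) (u n * t) / (1 - FZ (u n)).
have := hcond2 s0 st1; set bound := (fun n => _); move=> bound0.
have xb n : (((Num.sqrt (k n)%:R)%:E * `|x n - l|%:E) <= bound n)%E.
  rewrite /bound lee_wpmul2l// ?lee_fin ?sqrtr_ge0//.
  apply: ereal_sup_ubound; exists (s, t) => /=.
    by split => //; rewrite ltrDl.
  congr (`|fine (P _) / _ - _|%:E); apply/seteqP; split => w /=.
    by move=> [-> -> ->].
  by move=> /andP[/andP[-> ->] ->].
(* The limsup is 0 and the sequence is nonnegative, so it converges to 0; the factor
   [Num.sqrt (k n)], eventually at least 1, can then be dropped. *)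
have bound_cvg : bound n @[n --> \oo] --> 0%E.
  apply: limn_esup_le_cvg; first by rewrite bound0.
  by move=> n; apply: le_trans (xb n); rewrite mule_ge0// lee_fin ?sqrtr_ge0.
have kpos : \forall n \near \oo, (0 < k n)%N by move/cvgnyPgt : hk; exact.
have xl : x n @[n --> \oo] --> l.
  apply/cvgrPdist_le => e e0.
  have be : \forall n \near \oo, (bound n < e%:E)%E.
    move/fine_cvgP : bound_cvg => [bfin /cvgr_lt/(_ e e0) blt].
    near=> n; have bf : bound n \is a fin_num by near: n; exact: bfin.
    by rewrite -(fineK bf) lte_fin; near: n; exact: blt.
  near=> n; rewrite distrC -lee_fin.
  have bn : (bound n < e%:E)%E by near: n; exact: be.
  apply: le_trans (ltW bn); apply: le_trans (xb n).
  rewrite -EFinM lee_fin ler_peMl// -[leLHS]sqrtr1 ler_wsqrtr// ler1n.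
  by near: n; exact: kpos.
apply: cvg_trans xl; apply: near_eq_cvg; near=> n.
have n0 : 0 < n%:R :> R by rewrite ltr0n; near: n; exact: nbhs_infty_gt.
rewrite /x (_ : (k n)%:R = n%:R * (1 - FZ (u n))); last by apply/esym; near: n; exact: huk.
by field; rewrite !gt_eqF ?tail_FZ_gt0.
Unshelve. all: by end_near. Qed.

Let mexceed_fun x i : measurable_fun setT (fun w => x < Z i w).
Proof. by apply: measurable_fun_ltr => //; exact: measurable_Z. Qed.

Let mwindow_fun x y i : measurable_fun setT (fun w => (x < Z i w <= y) && delta i w).
Proof.
apply: measurable_and; last exact: measurable_delta.
apply: measurable_and; first exact: mexceed_fun.
by apply: measurable_fun_ler => //; exact: measurable_Z.
Qed.

Lemma exceed_vanishing x eps : 0 < x -> 0 < eps ->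
  vanishing P (fun n => [set w |
    eps < `|exceed (Z^~ w) (k n) n (u n * x) - x `^ (- gamma^-1)|]).
Proof.
move=> x0 e0.
apply: (@weak_law _ _ _ P (fun n i w => u n * x < Z i w)
  (fun n => 1 - FZ (u n * x))) => //.
- by move=> n i; rewrite exceed_ident exceed_prob.
- by move=> n i j; exact: exceed_indep.
- exact: exceed_rate.
Qed.

Lemma window_vanishing s t eps : 0 < s -> s <= t -> 0 < eps ->
  vanishing P (fun n => [set w |
    eps < `|window (Z^~ w) (delta^~ w) (k n) n (u n * s) (u n * t) -
            p * (s `^ (- gamma^-1) - t `^ (- gamma^-1))|]).
Proof.
move=> s0 st e0.
apply: (@weak_law _ _ _ P
  (fun n i w => (u n * s < Z i w <= u n * t) && delta i w)
  (fun n => window_prob (u n * s) (u n * t))) => //.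
- move=> n i; rewrite window_ident /window_prob fineK// fin_num_measure//.
  exact: measurable_bool_set.
- by move=> n i j; exact: window_indep.
- exact: window_rate.
Qed.
End tail_limits.

(** * Consistency *)

(** At least [n - k] of the [n] values are at most [x] exactly when at most [k] exceed it. *)
Lemma order_stat_le_exceed (R : realType) (z : nat -> R) k n x : (0 < k < n)%N ->
  (order_stat z (n - k) n <= x) = (exceed z k n x <= 1).
Proof.
move=> /andP[k0 kn]; rewrite order_stat_le; last lia.
rewrite /exceed mulrC ler_pdivrMr ?ltr0n// mul1r -!natr_sum ltr_nat ler_nat.
have : (\sum_(i < n) (z i <= x)%R + \sum_(i < n) (x < z i)%R = n)%N.
  rewrite -big_split/= -[RHS]card_ord -sum1_card; apply: eq_bigr => i _.
  by case: leP.
move: (\sum_(i < n) _)%N (\sum_(i < n) _)%N => a b ab.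
by apply/idP/idP; lia.
Qed.

Lemma mesh_error_small (R : realType) (c alpha L eps : R) :
  0 < c -> 0 < alpha -> 0 < L -> 0 < eps ->
  exists (m : nat) (eta : R), [/\ (0 < m)%N, 0 < eta, eta < 1 &
    2 * (c * (L / m%:R) + ((1 + eta) / (1 - eta) * expR (alpha * (L / m%:R)) - 1) *
           (c * (L / m%:R)) * m%:R) <= eps].
Proof.
move=> c0 a0 L0 e0.
(* The target for [sigma - 1]: [h] makes the accumulated error [h * (c * L)] at most [eps / 4], and
   [h <= 1] gives [(1 + h / 3) ^+ 2 <= 1 + h]. *)
pose h := Num.min 1 (eps / (4 * c * L)).
have cL0 : 0 < 4 * c * L by rewrite !mulr_gt0.
have h0 : 0 < h by rewrite lt_min ltr01 divr_gt0.
have h1 : h <= 1 by rewrite ge_min lexx.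
have hcL : 4 * (h * (c * L)) <= eps.
  have : h <= eps / (4 * c * L) by rewrite ge_min lexx orbT.
  by rewrite ler_pdivlMr// => hh; rewrite (le_trans _ hh)// le_eqVlt; apply/orP; left;
      apply/eqP; ring.
have ln0 : 0 < ln (1 + h / 3) by rewrite ln_gt0// ltrDl divr_gt0.
(* The first summand makes one cell contribute at most [eps / 4]; the second gives
   [expR (alpha * (L / m%:R)) <= 1 + h / 3]. *)
pose m := (Num.bound (4 * c * L / eps + alpha * L / ln (1 + h / 3))).+1.
have m0 : 0 < m%:R :> R by rewrite ltr0n.
have mb : 4 * c * L / eps + alpha * L / ln (1 + h / 3) <= m%:R.
  by rewrite (le_trans (ltW (unstable.ltr_bound _)))// ler_nat leqnSn.
have t1 : 0 <= 4 * c * L / eps by rewrite divr_ge0// ltW.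
have t2 : 0 <= alpha * L / ln (1 + h / 3) by rewrite divr_ge0 ?mulr_ge0// ltW.
have b1 : 4 * c * L <= m%:R * eps by rewrite -ler_pdivrMr//; lra.
have b2 : alpha * L <= m%:R * ln (1 + h / 3) by rewrite -ler_pdivrMr//; lra.
(* This [eta] solves [(1 + eta) / (1 - eta) = 1 + h / 3]. *)
exists m, (h / (6 + h)); split => //.
- by rewrite divr_gt0// addr_gt0.
- by rewrite ltr_pdivrMr ?addr_gt0//; lra.
have -> : (1 + h / (6 + h)) / (1 - h / (6 + h)) = 1 + h / 3.
  by field; apply/andP; split; [rewrite gt_eqF|]; lra.
have eb : expR (alpha * (L / m%:R)) <= 1 + h / 3.
  rewrite -[leRHS]lnK ?posrE ?addr_gt0 ?divr_gt0// ler_expR mulrA ler_pdivrMr//.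
  by rewrite [leRHS]mulrC.
have b3 : 4 * (c * (L / m%:R)) <= eps.
  by rewrite !mulrA ler_pdivrMr// [leRHS]mulrC.
rewrite -[X in _ + X]mulrA (_ : c * (L / m%:R) * m%:R = c * L); last first.
  by rewrite -mulrA divfK// gt_eqF.
have E0 : 0 < expR (alpha * (L / m%:R)) by exact: expR_gt0.
move: (expR _) eb E0 => E eb E0.
have : (1 + h / 3) * E - 1 <= h.
  have : (1 + h / 3) * E <= (1 + h / 3) * (1 + h / 3) by rewrite ler_wpM2l//; lra.
  have : h * h <= h by rewrite ler_piMl// ltW.
  by lra.
move=> /(ler_wpM2r (ltW (mulr_gt0 c0 L0))) => b4.
by rewrite mulrDr; lra.
Qed.

Section good_event.
Context {d : measure_display} {T : measurableType d} {R : realType}.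
Variable P : probability T R.

(** [G n] is the bad event: some grid count is off, or one of the two counts locating the order
    statistic is. The grid is fixed before [n], so this is a finite union of vanishing events. *)
Lemma na_close_event (Z : nat -> T -> R) (delta : nat -> T -> bool)
    (k : nat -> nat) (u : nat -> R) (alpha p A eps : R) :
  0 < alpha -> 0 < p -> 1 < A -> 0 < eps ->
  (\forall n \near \oo, 0 < u n) ->
  (\forall n \near \oo, (0 < k n < n)%N) ->
  (forall x e, 0 < x -> 0 < e -> vanishing P (fun n => [set w |
    e < `|exceed (Z^~ w) (k n) n (u n * x) - x `^ (- alpha)|])) ->
  (forall s t e, 0 < s -> s <= t -> 0 < e -> vanishing P (fun n => [set w |
    e < `|window (Z^~ w) (delta^~ w) (k n) n (u n * s) (u n * t) -
            p * (s `^ (- alpha) - t `^ (- alpha))|])) ->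
  exists2 G : nat -> set T, vanishing P G &
    \forall n \near \oo, forall w, ~ G n w ->
      let v := order_stat (Z^~ w) (n - k n) n in
      0 < v /\ forall t, 1 <= t <= A ->
        `|na_sum (Z^~ w) (delta^~ w) n v t - p * alpha * ln t| <= eps.
Proof.
move=> a0 p0 A1 e0 u0 kn ev wv.
have A0 : 0 < A by rewrite (lt_trans ltr01).
have L0 : 0 < ln (4 * A) by rewrite ln_gt0//; lra.
have [m [eta [m0 eta0 eta1 err]]] := mesh_error_small (mulr_gt0 p0 a0) a0 L0 e0.
set delt := ln (4 * A) / m%:R in err.
have delt0 : 0 < delt by rewrite divr_gt0// ltr0n.
pose g j := grid delt j.
have g0 j : 0 < g j := grid_gt0 delt j.
pose s j := g j `^ (- alpha).
have s0 j : 0 < s j by rewrite powR_gt0.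
have sdec j : s j.+1 < s j.
  rewrite /s !powRN ltf_pV2 ?posrE ?powR_gt0//.
  apply: gt0_ltr_powR; rewrite ?nnegrE ?ltW//.
  by rewrite /g /grid ltr_pM2r ?invr_gt0// ltr_expR ltr_pM2r// ltr_nat.
pose B j n := [set w | eta * s j < `|exceed (Z^~ w) (k n) n (u n * g j) - s j|].
pose C j n := [set w | eta * (p * (s j - s j.+1)) <
   `|window (Z^~ w) (delta^~ w) (k n) n (u n * g j) (u n * g j.+1) - p * (s j - s j.+1)|].
have ln2 : 0 < ln 2 :> R by rewrite ln_gt0// ltr1n.
have lo : 2 `^ (- alpha) < 1.
  by rewrite /powR gt_eqF// expR_lt1 mulNr oppr_lt0 mulr_gt0.
have up : 1 < 2^-1 `^ (- alpha).
  by rewrite /powR gt_eqF ?invr_gt0// expR_gt1 lnV ?posrE// mulrNN mulr_gt0.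
(* The limits of [exceed] at [u n / 2] and [2 * u n] lie strictly above and below 1. An error of at
   most half the gap keeps the counts on their sides of 1, which encloses the order statistic. *)
pose V1 n := [set w | (2^-1 `^ (- alpha) - 1) / 2 <
   `|exceed (Z^~ w) (k n) n (u n * 2^-1) - 2^-1 `^ (- alpha)|].
pose V2 n := [set w | (1 - 2 `^ (- alpha)) / 2 <
   `|exceed (Z^~ w) (k n) n (u n * 2) - 2 `^ (- alpha)|].
exists (fun n => (\big[setU/set0]_(j < m.+1) B j n `|` \big[setU/set0]_(j < m) C j n) `|`
   (V1 n `|` V2 n)).
  apply: vanishing_setU; apply: vanishing_setU.
  - by apply: vanishing_bigsetU => j _; apply: ev => //; rewrite mulr_gt0.
  - apply: vanishing_bigsetU => j _; apply: wv => //; first exact: grid_mono.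
    by rewrite !mulr_gt0// subr_gt0.
  - by apply: ev => //; rewrite ?invr_gt0// divr_gt0// subr_gt0.
  - by apply: ev => //; rewrite divr_gt0// subr_gt0.
near=> n => w nG.
have un : 0 < u n by near: n; exact: u0.
have kn' : (0 < k n < n)%N by near: n; exact: kn.
have [k0 _] := andP kn'.
have nB j : (j <= m)%N -> ~ B j n w.
  move=> jm Bj; apply: nG; left; left.
  by rewrite -(bigcup_mkord m.+1 (fun j => B j n)); exists j.
have nC j : (j < m)%N -> ~ C j n w.
  move=> jm Bj; apply: nG; left; right.
  by rewrite -(bigcup_mkord m (fun j => C j n)); exists j.
have nV1 : ~ V1 n w by move=> V; apply: nG; right; left.
have nV2 : ~ V2 n w by move=> V; apply: nG; right; right.
have vu : u n / 2 <= order_stat (Z^~ w) (n - k n) n <= 2 * u n.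
  apply/andP; split.
    rewrite leNgt; apply/negP => /ltW; rewrite order_stat_le_exceed// => x1.
    move: nV1; rewrite /V1/= => /negP; rewrite -leNgt ler_norml => /andP[h1 h2].
    by lra.
  rewrite mulrC order_stat_le_exceed//.
  move: nV2; rewrite /V2/= => /negP; rewrite -leNgt ler_norml => /andP[h1 h2].
  by lra.
split; first by have /andP[h _] := vu; rewrite (lt_le_trans _ h)// divr_gt0.
move=> t tA; apply: le_trans err.
apply: (@na_sum_close _ _ _ (k n) n k0 alpha p delt eta (u n) a0 p0 delt0 eta0 eta1 un m _ _ _ A t) => //.
- by move=> j /nB/negP; rewrite -leNgt.
- by move=> j /nC/negP; rewrite -leNgt.
- by rewrite /delt mulrC divfK// gt_eqF// ltr0n.
Unshelve. all: by end_near. Qed.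

End good_event.

Lemma near_threshold_count (R : realType) (k : nat -> nat) :
  k n @[n --> \oo] --> \oo -> ((k n)%:R / n%:R) @[n --> \oo] --> (0 : R) ->
  \forall n \near \oo, (0 < k n < n)%N.
Proof.
move=> hk hkn.
have kpos : \forall n \near \oo, (0 < k n)%N by move/cvgnyPgt : hk; exact.
have klt : \forall n \near \oo, (k n)%:R / n%:R < 1 :> R.
  by move/cvgr_lt : hkn; apply; exact: ltr01.
near=> n; apply/andP; split; first by near: n; exact: kpos.
have n0 : 0 < n%:R :> R by rewrite ltr0n; near: n; exact: nbhs_infty_gt.
have : (k n)%:R / n%:R < 1 :> R by near: n; exact: klt.
by rewrite ltr_pdivrMr// mul1r ltr_nat.
Unshelve. all: by end_near. Qed.

Theorem theorem5 (d : measure_display) (T : measurableType d) (R : realType)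
  (P : probability T R)
  (X Y : nat -> {RV P >-> R}) (FX FY LX LY : R -> R) (gammaX gammaY : R)
  (* two independent i.i.d. sequences *)
  (hindep : mutually_independent
    (fun i : nat + nat => match i with inl j => X j | inr j => Y j end))
  (hX : forall i x, cdf (X i) x = (FX x)%:E)
  (hY : forall i x, cdf (Y i) x = (FY x)%:E)
  (* regularly varying tails *)
  (hgX : 0 < gammaX) (hgY : 0 < gammaY)
  (hLX : slowly_varying LX) (hLY : slowly_varying LY)
  (hFX : forall x : R, 0 < x -> 1 - FX x = LX x * x `^ (- gammaX^-1))
  (hFY : forall x : R, 0 < x -> 1 - FY x = LY x * x `^ (- gammaY^-1))
  (* observations *)
  (Z : nat -> T -> R) (delta : nat -> T -> bool)
  (hZ : forall i w, Z i w = Num.min (X i w) (Y i w))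
  (hdelta : forall i w, delta i w = (X i w <= Y i w))
  (gamma p : R)
  (hgamma : gamma = gammaX * gammaY / (gammaX + gammaY))
  (hp : p = gammaY / (gammaX + gammaY))
  (* intermediate sequence and thresholds *)
  (k : nat -> nat) (u : nat -> R) (FZ : R -> R)
  (hk : k n @[n --> \oo] --> \oo)
  (hkn : ((k n)%:R / n%:R) @[n --> \oo] --> (0 : R))
  (hFZ : FZ = dist_fun P (Z 0%N))
  (hu : forall n, u n = quantile FZ (1 - (k n)%:R / n%:R))
  (huk : \forall n \near \oo, n%:R * (1 - FZ (u n)) = (k n)%:R :> R)
  (* Condition 1 *)
  (hcond1 : (Num.sqrt (k n)%:R *
      (cond_prob P [set w | delta 0%N w] [set w | u n < Z 0%N w] - p))
      @[n --> \oo] --> (0 : R))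
  (hcond2 : forall a b : R, 0 < a -> a < b ->
    limn_esup (fun n : nat => ((Num.sqrt (k n)%:R)%:E *
      ereal_sup [set (`| fine (P [set w | [/\ (u n * st.1 < Z 0%N w)%R,
                                              (Z 0%N w <= u n * st.2)%R
                                            & delta 0%N w]]) / (1 - FZ (u n))
                        - p * (st.1 `^ (- gamma^-1)
                               - st.2 `^ (- gamma^-1)) |%R)%:E
                | st in [set st : R * R |
                          [/\ (a <= st.1)%R, (st.1 <= st.2)%R
                            & (st.2 < b)%R]]])%E)
    = 0%E)
  (A : R) (hA : 1 < A) :
  cvg_in_prob0 P (fun n w =>
    sup_dist 1 A (nelson_aalen (Z^~ w) (delta^~ w) (k n) n)
                 (fun t => gammaX^-1 * ln t)) /\
  cvg_in_prob0 P (fun n w =>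
    sup_dist 1 A (kaplan_meier (Z^~ w) (delta^~ w) (k n) n)
                 (fun t => 1 - t `^ (- gammaX^-1))).
Proof.
subst FZ.
have gam0 : 0 < gamma by rewrite hgamma divr_gt0 ?mulr_gt0 ?addr_gt0.
have alpha0 : 0 < gamma^-1 by rewrite invr_gt0.
have p0 : 0 < p by rewrite hp divr_gt0// addr_gt0.
(* Identifies the slope [p * alpha] obtained on the grid with that of the limit. *)
have pgamma : p * gamma^-1 = gammaX^-1.
  by rewrite hp hgamma; field; rewrite !gt_eqF ?addr_gt0.
have u_oo := threshold_pinfty hindep hX hY hLX hLY hFX hFY hZ hkn huk.
have u0 : \forall n \near \oo, 0 < u n by exact: (u_oo _ (nbhs_pinfty_gt (num_real 0))).
have kn := near_threshold_count hk hkn.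
have ev x e (x0 : 0 < x) (e0 : 0 < e) :=
  exceed_vanishing hindep hX hY hgX hgY hLX hLY hFX hFY hZ hgamma hk hkn huk x0 e0.
have wv s t e (s0 : 0 < s) (st : s <= t) (e0 : 0 < e) :=
  window_vanishing hindep hX hY hLX hLY hFX hFY hZ hdelta hk huk hcond2 s0 st e0.
have mZ := measurable_Z hZ.
have mD := measurable_delta hdelta.
have c0 : 0 < gammaX^-1 by rewrite invr_gt0.
have A1 := ltW hA.
have lnA : 0 <= ln A by rewrite ln_ge0.
split=> eps eps0.
  have [G vG Gclose] := na_close_event alpha0 p0 hA eps0 u0 kn ev wv.
  apply: (vanishing_sub vG); apply: filterS2 Gclose kn => n Gn /andP[k0 _].
  split.
    apply: (measurable_eps_lt_sup_dist _ A1).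
    - by move=> t; exact: measurable_nelson_aalen.
    - by move=> w t _; exact: nelson_aalen_near.
    - move=> t /andP[t1 _]; apply: cvgM; first exact: cvg_cst.
      by apply: cvg_at_right_filter; apply: continuous_ln; rewrite (lt_le_trans ltr01).
  move=> w /(lt_sup_distP _ _ _ A1)[t tA]; apply: contraPP => nG.
  apply/negP; rewrite -leNgt.
  have [v0 close] := Gn w nG.
  by rewrite nelson_aalenE// -pgamma; exact: close.
have c4 : 0 < 4 * gammaX^-1 * ln A + 2.
  by rewrite ltr_wpDl// !mulr_ge0// ltW.
(* The first bound is required by [km_prod_close]; the second brings its final error below [eps]. *)
pose e := Num.min 4^-1 (eps / (4 * gammaX^-1 * ln A + 2)).
have e0 : 0 < e by rewrite lt_min invr_gt0 ltr0n/= divr_gt0.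
have e4 : e <= 4^-1 by rewrite ge_min lexx.
have ee : e * (4 * gammaX^-1 * ln A + 2) <= eps.
  by rewrite -ler_pdivlMr// ge_min lexx orbT.
have [G vG Gclose] := na_close_event alpha0 p0 hA e0 u0 kn ev wv.
apply: (vanishing_sub vG); apply: filterS2 Gclose kn => n Gn /andP[k0 _].
split.
  apply: (measurable_eps_lt_sup_dist _ A1).
  - by move=> t; exact: measurable_kaplan_meier.
  - by move=> w t _; exact: kaplan_meier_near.
  - move=> t /andP[t1 _]; apply: cvgB; first exact: cvg_cst.
    apply: cvg_at_right_filter.
    have : differentiable ((@powR R) ^~ (- gammaX^-1)) t.
      by apply/derivable1_diffP/derivable_powR; rewrite in_itv/= andbT (lt_le_trans ltr01).
    by move=> /differentiable_continuous.
move=> w /(lt_sup_distP _ _ _ A1)[t tA]; apply: contraPP => nG.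
apply/negP; rewrite -leNgt; apply: le_trans ee.
have [v0 close] := Gn w nG.
rewrite kaplan_meierE// (_ : forall a b : R, 1 - a - (1 - b) = b - a); last by move=> *; ring.
rewrite distrC.
apply: (km_prod_close v0 (ltW c0) e0 e4 _ tA) => s sA.
by rewrite -pgamma; exact: close.
Qed.
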